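(* Let $g\ge 0$, let $\mu$ and $\nu$ be partitions of $d\geq 1$ of lengths $m$ and $n$, and let $r=2g-2+m+n$, with $r\ge 1$. Let $(\Gamma\subset\Sigma,w)$ be a $(\mu,\nu,g)$-Hurwitz ribbon graph. Place $w(e)$ tick marks in the interior of each edge $e$ of $\Gamma$ and choose a bijection between the resulting $d$ tick marks and $\{1,\dots,d\}$. For $0\le i\le r$ define $\sigma_i$ as follows: to find $\sigma_i(x)$, start at the tick mark labeled $x$ and travel along the edges of $\Gamma$ in their natural orientation until the next tick mark is reached, where, each time a vertex is reached, one turns left onto the adjacent outgoing edge if the label of the vertex is greater than $i$, and turns right onto the adjacent outgoing edge if the label of the vertex is less than or equal to $i$; $\sigma_i(x)$ is the label of the tick mark reached. Then each $\sigma_i$ is a well-defined permutation of $\{1,\dots,d\}$; the cycles of $\sigma_0$ are in bijection with the white faces (each cycle consisting of the tick marks on the boundary of the face) and the cycles of $\sigma_r$ are in the same way in bijection with the gray faces, so that the cycles of $\sigma_0$ and $\sigma_r$ inherit labels from the faces; and with these labels $(\sigma_0,\dots,\sigma_r)$ is a $(\mu,\nu,g)$-monodromy sequence. Its isomorphism class does not depend on the choice of labeling of the tick marks, and the resulting map is a bijection from isomorphism classes of $(\mu,\nu,g)$-Hurwitz ribbon graphs to isomorphism classes of $(\mu,\nu,g)$-monodromy sequences.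
   Context: Ribbon graphs. A ribbon graph is a pair $\Gamma\subset\Sigma$ of a graph $\Gamma$ (loops and multiple edges allowed) embedded in a closed connected oriented topological surface $\Sigma$ such that each component of $\Sigma\setminus\Gamma$ (a face) is an open disk. It is bicolored if its faces are colored gray and white so that each edge separates a gray face from a white face. The natural orientation of an edge is the one for which, traveling along the edge, the gray face is on the right and the white face is on the left. An $(m,n,r)$-ribbon graph is a bicolored ribbon graph all of whose vertices are 4-valent, with $r$ vertices labeled $1,\dots,r$, with $m$ white faces labeled $1,\dots,m$ and with $n$ gray faces labeled $1,\dots,n$. (At each vertex, incoming and outgoing edge-ends alternate cyclically, so on arriving along an incoming edge there is one outgoing edge immediately to the left and one immediately to the right.) Hurwitz ribbon graphs. An edge weighting $w$ of an $(m,n,r)$-ribbon graph is positive if $w(e)$ is a nonnegative integer for every edge $e$, and $w(e)>0$ whenever $e$ is naturally oriented from vertex $i$ to vertex $j$ with $i\ge j$. It is $(\mu,\nu)$-balanced if, for each $i$, the sum of $w(e)$ over the edges $e$ incident to the $i$th white face is $\mu_i$ and, for each $j$, the sum of $w(e)$ over the edges $e$ incident to the $j$th gray face is $\nu_j$. A $(\mu,\nu,g)$-Hurwitz ribbon graph is an $(m,n,r)$-ribbon graph, with $r=2g-2+m+n$, together with an edge weighting that is positive and $(\mu,\nu)$-balanced. Isomorphisms of Hurwitz ribbon graphs are orientation-preserving isomorphisms of the underlying cell complexes preserving the labels of the vertices and faces, the colors, and the edge weights. Monodromy sequences. Permutations are composed right to left. A $(\mu,\nu,g)$-monodromy sequence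 is a tuple $(\sigma_0,\dots,\sigma_r)\in S_d^{r+1}$, with $r=2g-2+m+n$, together with labelings of the cycles (fixed points included) of $\sigma_0$ by $\{1,\dots,m\}$ and of $\sigma_r$ by $\{1,\dots,n\}$, such that: the $i$th cycle of $\sigma_0$ has length $\mu_i$ and the $j$th cycle of $\sigma_r$ has length $\nu_j$; for each $1\le i\le r$ the permutation $\tau_i=\sigma_i\sigma_{i-1}^{-1}$ is a transposition; and the group generated by $\sigma_0,\tau_1,\dots,\tau_r$ acts transitively on $\{1,\dots,d\}$. (Thus $\sigma_i=\tau_i\cdots\tau_1\sigma_0$; setting $\sigma_\infty=\sigma_r^{-1}$, this is the same data as a tuple $(\sigma_0,\tau_1,\dots,\tau_r,\sigma_\infty)$.) An isomorphism from $(\sigma_0,\dots,\sigma_r)$ to $(\sigma_0',\dots,\sigma_r')$ is an element $h\in S_d$ with $h^{-1}\sigma_ih=\sigma_i'$ for all $i$ such that this conjugation preserves the labels of the cycles of $\sigma_0$ and $\sigma_r$. *)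

(* Defs.v *)
From HB Require Import structures.
From mathcomp Require Import all_boot all_fingroup.

Set Implicit Arguments.
Unset Strict Implicit.
Unset Printing Implicit Defensive.

(** * Labelings, partitions, isomorphism classes *)

(* The label set {1, ..., k} is represented by 'I_k: the ordinal [i] stands for
   the label [i.+1].  A labeling of the finite set [A] is a bijection from the
   labels onto [A]; [l i] is the element of [A] carrying the label [i.+1]. *)
Definition is_labeling (T : finType) (k : nat) (A : {set T}) (l : 'I_k -> T) :=
  injective l /\ l @: [set: 'I_k] = A.

Definition is_partition (d : nat) (s : seq nat) : bool :=
  [&& sorted geq s, 0 \notin s & sumn s == d].

Definition iso_class (T : Type) (R : T -> T -> Prop) : Type :=
  {C : T -> Prop | exists x, C = R x}.

Definition class_of (T : Type) (R : T -> T -> Prop) (x : T) : iso_class R :=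
  exist _ (R x) (ex_intro _ x erefl).

(* The number 2g - 2 + m + n.  The subtraction does not truncate when m and n
   are positive. *)
Definition num_branch (g m n : nat) : nat := (2 * g + m + n - 2)%N.

(** * Ribbon graphs *)

(* A graph with at least one edge, cellularly embedded in a closed connected
   oriented surface, is encoded by its combinatorial map (rotation system).
   The darts are the edge-ends; a dart is also viewed as its edge directed away
   from the vertex at which the edge-end sits.  [opp x] is the other end of the
   edge of [x], and [rot x] is the next edge-end after [x] in the
   counterclockwise order around the vertex of [x]. *)
Record ribbon_graph := RibbonGraph {
  dart :> finType;
  opp : {perm dart};
  rot : {perm dart};
  oppK : involutive opp;
  opp_neq : forall x, opp x != x;
  ribbon_connected : [transitive <<[set opp; rot]>>, on [set: dart] | 'P]
}.

(* Travel along [x] to its far end, reached at the edge-end [opp x].  The edge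
   immediately to the left is the one following [opp x] clockwise, the edge
   immediately to the right is the one following it counterclockwise. *)
Definition turn_left (G : ribbon_graph) : {perm G} := (opp G * (rot G)^-1)%g.
Definition turn_right (G : ribbon_graph) : {perm G} := (opp G * rot G)%g.

Definition vertices (G : ribbon_graph) : {set {set G}} := porbits (rot G).

(* Always turning left follows the boundary of the face lying on the left.  A
   face is the set of darts having it on their left, so [face_of x] is the face
   on the left of [x], and [face_of (opp G x)] the face on its right. *)
Definition faces (G : ribbon_graph) : {set {set G}} := porbits (turn_left G).
Definition face_of (G : ribbon_graph) (x : G) : {set G} :=
  porbit (turn_left G) x.

Record bicolored_graph := BicoloredGraph {
  bicolored_ribbon :> ribbon_graph;
  white : {set {set bicolored_ribbon}};
  white_faces : white \subset faces bicolored_ribbon;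
  edge_separates : forall x : bicolored_ribbon,
    (face_of (opp bicolored_ribbon x) \in white) = (face_of x \notin white)
}.

Definition gray (G : bicolored_graph) : {set {set G}} := faces G :\: white G.

(* [x] points in the natural direction of its edge: the face on the left is
   white, hence the face on the right is gray. *)
Definition natural (G : bicolored_graph) (x : G) : bool :=
  face_of x \in white G.

Record mnr_graph (m n r : nat) := MnrGraph {
  mnr_bicolored :> bicolored_graph;
  four_valent : forall V, V \in vertices mnr_bicolored -> #|V| = 4;
  vertex : 'I_r -> {set mnr_bicolored};
  white_face : 'I_m -> {set mnr_bicolored};
  gray_face : 'I_n -> {set mnr_bicolored};
  vertexP : is_labeling (vertices mnr_bicolored) vertex;
  white_faceP : is_labeling (white mnr_bicolored) white_face;
  gray_faceP : is_labeling (gray mnr_bicolored) gray_face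
}.

(** * Hurwitz ribbon graphs *)

(* The weight of an edge is carried by both of its darts.  Since each edge has
   one white and one gray side, it has exactly one dart in exactly one white
   face, and likewise for gray faces; summing over the darts of a face is thus
   summing over the edges incident to it. *)
Record hurwitz_graph (g m n : nat) (mu : m.-tuple nat) (nu : n.-tuple nat) :=
  HurwitzGraph {
  hurwitz_mnr :> mnr_graph m n (num_branch g m n);
  weight : hurwitz_mnr -> nat;
  weight_opp : forall x, weight (opp hurwitz_mnr x) = weight x;
  weight_positive : forall (x : hurwitz_mnr) (i j : 'I_(num_branch g m n)),
    natural x -> x \in vertex hurwitz_mnr i ->
    opp hurwitz_mnr x \in vertex hurwitz_mnr j -> j <= i -> 0 < weight x;
  white_balanced : forall i : 'I_m,
    \sum_(x in white_face hurwitz_mnr i) weight x = tnth mu i;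
  gray_balanced : forall j : 'I_n,
    \sum_(x in gray_face hurwitz_mnr j) weight x = tnth nu j
}.

Definition hurwitz_iso (g m n : nat) (mu : m.-tuple nat) (nu : n.-tuple nat)
    (G H : hurwitz_graph g mu nu) : Prop :=
  exists f : G -> H,
  [/\ bijective f,
      (forall x, f (opp G x) = opp H (f x))
        /\ (forall x, f (rot G x) = rot H (f x)),
      (forall F, F \in faces G -> (f @: F \in white H) = (F \in white G)),
      [/\ forall i, f @: vertex G i = vertex H i,
          forall i, f @: white_face G i = white_face H i
        & forall j, f @: gray_face G j = gray_face H j]
    & forall x, weight (f x) = weight x].

(** * Monodromy sequences *)

(* Composition of permutations from right to left; the product of the library
   composes from left to right. *)
Definition comp_perm (T : finType) (s t : {perm T}) : {perm T} := (t * s)%g.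

Lemma comp_permE (T : finType) (s t : {perm T}) x : comp_perm s t x = s (t x).
Proof. exact: permM. Qed.

Definition is_transposition (T : finType) (s : {perm T}) : Prop :=
  exists x y : T, x != y /\ s = tperm x y.

(* For [i : 'I_r], the permutation tau_(i+1) = sigma_(i+1) sigma_i^-1. *)
Definition tau (d r : nat) (sigma : 'I_r.+1 -> {perm 'I_d}) (i : 'I_r) :
    {perm 'I_d} :=
  comp_perm (sigma (lift ord0 i)) (sigma (widen_ord (leqnSn r) i))^-1%g.

Record monodromy_sequence (g d m n : nat)
    (mu : m.-tuple nat) (nu : n.-tuple nat) := MonodromySequence {
  sigma : 'I_(num_branch g m n).+1 -> {perm 'I_d};
  first_cycle : 'I_m -> {set 'I_d};
  last_cycle : 'I_n -> {set 'I_d};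
  first_cycleP : is_labeling (porbits (sigma ord0)) first_cycle;
  last_cycleP : is_labeling (porbits (sigma ord_max)) last_cycle;
  card_first_cycle : forall i, #|first_cycle i| = tnth mu i;
  card_last_cycle : forall j, #|last_cycle j| = tnth nu j;
  tau_transposition : forall i, is_transposition (tau sigma i);
  monodromy_transitive :
    [transitive <<sigma ord0 |: [set tau sigma i | i : 'I_(num_branch g m n)]>>,
       on [set: 'I_d] | 'P]
}.

(* Conjugation s |-> h^-1 s h carries a cycle C of s to h^-1 (C). *)
Definition monodromy_iso (g d m n : nat)
    (mu : m.-tuple nat) (nu : n.-tuple nat)
    (M N : monodromy_sequence g d mu nu) : Prop :=
  exists h : {perm 'I_d},
  [/\ forall i, comp_perm h^-1%g (comp_perm (sigma M i) h) = sigma N i,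
      forall i, h^-1%g @: first_cycle M i = first_cycle N i
    & forall j, h^-1%g @: last_cycle M j = last_cycle N j].

(** * Traveling between tick marks *)

Section Travel.

Variables (g m n : nat) (mu : m.-tuple nat) (nu : n.-tuple nat).
Variable G : hurwitz_graph g mu nu.

(* The tick mark (x, k) lies on the edge of the naturally oriented dart [x];
   the tick marks of that edge are numbered 0, 1, ... in the natural direction
   of travel. *)
Definition tick := {t : {x : G & 'I_(weight x)} | natural (tag t)}.

Definition tick_dart (t : tick) : G := tag (val t).
Definition tick_pos (t : tick) : nat := tagged (val t).

(* The dart taken after traveling along [x], for the turning rule of sigma_s:
   turn left iff the vertex reached has a label greater than [s]. *)
Definition turn (s : nat) (x : G) : G :=
  if [exists v, (opp G x \in vertex G v) && (s < v.+1)]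
  then turn_left G x else turn_right G x.

(* [first_tick s x t]: traveling from the starting vertex of [x] along [x],
   [t] is the first tick mark reached. *)
Inductive first_tick (s : nat) : G -> tick -> Prop :=
| FirstTickHere (t : tick) : tick_pos t = 0 -> first_tick s (tick_dart t) t
| FirstTickLater (x : G) (t : tick) :
    weight x = 0 -> first_tick s (turn s x) t -> first_tick s x t.

Definition next_tick (s : nat) (t u : tick) : Prop :=
  tick_dart u = tick_dart t /\ tick_pos u = (tick_pos t).+1
  \/ (tick_pos t).+1 = weight (tick_dart t)
     /\ first_tick s (turn s (tick_dart t)) u.

(* The labels of the tick marks on the boundary of the face [F]; the label [k]
   is placed at the tick mark [lab k]. *)
Definition ticks_on (d : nat) (lab : 'I_d -> tick) (F : {set G}) : {set 'I_d} :=
  [set k | (tick_dart (lab k) \in F) || (opp G (tick_dart (lab k)) \in F)].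

Definition traces (d : nat) (lab : 'I_d -> tick)
    (M : monodromy_sequence g d mu nu) : Prop :=
  [/\ forall (i : 'I_(num_branch g m n).+1) k,
        next_tick i (lab k) (lab (sigma M i k)),
      forall i, first_cycle M i = ticks_on lab (white_face G i)
    & forall j, last_cycle M j = ticks_on lab (gray_face G j)].

End Travel.

(* Main.v *)
Require Import Defs.
From mathcomp Require Import all_boot all_fingroup.
From mathcomp Require Import zify boolp.

(** Call [i] the level of the vertex labeled [i+1] and of the two natural edges
    leaving it.  Since edges without tick marks go up, the path from one tick
    mark to the next meets each level at most once, and the rules of sigma_i and
    sigma_(i+1) differ on it only at the vertex of level [i].  Hence tau_(i+1)
    exchanges the first tick marks [y] and [y'] met after leaving that vertex
    along its two outgoing edges, and a natural edge is determined by the pair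
    [(i, y)], where tau_(i+1) moves [y].

    Conversely, given a monodromy sequence, let strands indexed by the tick marks
    pass the levels one after the other, the strand [y] being continued by the
    strand [sigma_0 y].  The pairs [(i, y)] such that tau_(i+1) moves [y] are the
    edges, the next such pair along the strands is the next edge when turning
    left, and the weight counts the strands completed in between.  Turning left
    along edges and jumping from tick mark to tick mark are both first return maps
    of this one flow, as are, for the flow that moreover crosses strands at the
    levels below [s], the turning rule of sigma_s and sigma_s itself; thus faces
    correspond to cycles. *)

Set Implicit Arguments.
Unset Strict Implicit.
Unset Printing Implicit Defensive.

(** Along an edge of weight [w] from level [i] to level [j] the flow takes [w * r + j - i] steps,
    since each tick mark is one passage of the top level. A first return time must be positive; for
    [w = 0] this says [i < j], and for [w > 0] it always holds. So positivity of the weighting is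
    exactly what a flow can realize.

    The obstacle is the edges of weight 0: they carry no tick mark and the permutations see them
    only through the first tick mark beyond them. Several may lead to the same tick mark, which is
    why an edge is recorded together with its level.

    The bijection on classes is not built from two inverse maps. A single relation, [realizes], is
    shown to be total on both sides, and each side to determine the other up to isomorphism. *)

Local Notation rot := Defs.rot.

(** * First return maps *)

Lemma porbit_mem_trans (T : finType) (p : {perm T}) (x y z : T) :
  y \in porbit p x -> z \in porbit p y -> z \in porbit p x.
Proof. by rewrite -eq_porbit_mem => /eqP <-. Qed.

Lemma porbit_eq (T : finType) (p : {perm T}) (x y : T) :
  y \in porbit p x -> porbit p y = porbit p x.
Proof. by rewrite -eq_porbit_mem => /eqP. Qed.

Lemma porbit_next (T : finType) (p : {perm T}) (x : T) : p x \in porbit p x.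
Proof. exact: (mem_porbit p 1 x). Qed.

Section FirstReturn.

Variables (T : finType) (p : {perm T}) (A : pred T).

(** If the orbit of [x] avoids [A], [find] returns the period and [entry x] is [x]; [meets] excludes
    this case. *)
Definition hit (x : T) : nat := find A (fingraph.orbit p x).
Definition entry (x : T) : T := iter (hit x) p x.
Definition first_return (x : T) : T := entry (p x).

Definition meets (x : T) : Prop := exists k, A (iter k p x).

Lemma hit_unique x k :
  A (iter k p x) -> (forall j, j < k -> ~~ A (iter j p x)) -> hit x = k.
Proof.
move=> Ak mink.
(* Past the period, the point would already occur at the index [findex], against the minimality of
   [k]. *)
have lt_k : k < fingraph.order p x.
  have cxk : fconnect p x (iter k p x) by exact: fconnect_iter.
  have := findex_max cxk; apply: leq_ltn_trans; rewrite leqNgt.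
  by apply/negP=> /mink; rewrite iter_findex // Ak.
have hasA : has A (fingraph.orbit p x).
  apply/hasP; exists (iter k p x) => //.
  by rewrite -fconnect_orbit fconnect_iter.
have lt_h : hit x < fingraph.order p x.
  by rewrite /hit -(fingraph.size_orbit p x) -has_find.
case: (ltngtP (hit x) k) => // lt.
  have := mink _ lt; have := nth_find x hasA.
  by rewrite -/(hit x) /fingraph.orbit nth_traject // => ->.
by have := before_find x lt; rewrite /fingraph.orbit nth_traject // Ak.
Qed.

Lemma hitP x : meets x ->
  A (iter (hit x) p x) /\ (forall j, j < hit x -> ~~ A (iter j p x)).
Proof.
move=> ex; case: (ex_minnP ex) => k Ak mink.
have mk j : j < k -> ~~ A (iter j p x).
  by move=> lt; apply/negP=> /mink; rewrite leqNgt lt.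
by rewrite (hit_unique Ak mk).
Qed.

Lemma entry_id x : A x -> entry x = x.
Proof. by move=> Ax; rewrite /entry (@hit_unique x 0). Qed.

Lemma meets_next x : meets (p x) -> meets x.
Proof. by case=> k; rewrite -iterSr => Ak; exists k.+1. Qed.

Lemma meets_next_out x : ~~ A x -> meets x -> meets (p x).
Proof.
move=> nAx [[|k] Ak]; first by rewrite /= (negPf nAx) in Ak.
by exists k; rewrite -iterSr.
Qed.

Lemma hit_next x : ~~ A x -> meets x -> hit x = (hit (p x)).+1.
Proof.
move=> nAx /(meets_next_out nAx) /hitP[A1 A2]; apply: hit_unique.
  by rewrite iterSr.
by case=> [|j] // lt; rewrite iterSr A2.
Qed.

Lemma entry_next x : ~~ A x -> meets x -> entry (p x) = entry x.
Proof. by move=> nAx mx; rewrite /entry (hit_next nAx mx) iterSr. Qed.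

Lemma meets_in x : A x -> meets (p x).
Proof.
move=> Ax; exists (#[p]%g).-1; rewrite -iterSr prednK ?order_gt0 //.
by rewrite -permX expg_order perm1.
Qed.

(** Cancelling the shorter hitting time, by injectivity of [p], leaves one starting point on the
    path of the other. *)
Lemma entry_confluent x y : meets x -> meets y -> entry x = entry y ->
  (exists2 k, y = iter k p x & forall j, j < k -> ~~ A (iter j p x)) \/
  (exists2 k, x = iter k p y & forall j, j < k -> ~~ A (iter j p y)).
Proof.
move=> /hitP[Ax nAx] /hitP[Ay nAy]; rewrite /entry.
have inj k : injective (iter k p).
  by elim: k => [//|k IH] u v /= /perm_inj /IH.
case: (leqP (hit x) (hit y)) => [le|/ltnW le] E.
  right; exists (hit y - hit x); last first.
    by move=> j lt; apply: nAy; apply: leq_trans lt (leq_subr _ _).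
  by apply: (inj (hit x)); rewrite -iterD subnKC.
left; exists (hit x - hit y); last first.
  by move=> j lt; apply: nAx; apply: leq_trans lt (leq_subr _ _).
by apply: (inj (hit y)); rewrite -iterD subnKC.
Qed.

(** If the path of [p x] ran into [p y] after at least one step, it would have been at [y], a point
    of [A], just before. *)
Lemma first_return_inj : {in A &, injective first_return}.
Proof.
move=> x y Ax Ay; rewrite /first_return.
case/(entry_confluent (meets_in Ax) (meets_in Ay)) => -[[|k]] E nA.
- exact/esym/(@perm_inj _ p).
- have := nA k (ltnSn _).
  by rewrite (_ : iter k p (p x) = y) ?[A y]Ay //; apply: (@perm_inj _ p).
- exact/(@perm_inj _ p).
- have := nA k (ltnSn _).
  by rewrite (_ : iter k p (p y) = x) ?[A x]Ax //; apply: (@perm_inj _ p).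
Qed.

Lemma first_return_in x : A x -> A (first_return x).
Proof. by move=> /meets_in /hitP[]. Qed.

Lemma entry_porbit x : entry x \in porbit p x.
Proof. by rewrite /entry -permX mem_porbit. Qed.

Lemma first_return_porbit x : first_return x \in porbit p x.
Proof. by rewrite /first_return /entry -iterSr -permX mem_porbit. Qed.

(** Strong induction on the number of [p]-steps from [x] to [y]: each first return uses at least one
    and does not overshoot [y]. *)
Lemma first_return_orbit x y : A x -> A y -> y \in porbit p x ->
  exists n, y = iter n first_return x.
Proof.
move=> Ax Ay /porbitP[k]; rewrite permX => yE.
have [n le_nk] := ubnP k; elim: n k le_nk x Ax yE => // n IHn k lt_kn x Ax yE.
case: k => [|k] in lt_kn yE *; first by exists 0.
have [A1 A2] := hitP (meets_in Ax).
have le : hit (p x) <= k.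
  rewrite leqNgt; apply/negP=> /A2.
  by rewrite -iterSr -yE Ay.
have := IHn (k - hit (p x)) _ _ (first_return_in Ax).
case=> [||m ->].
- by move: lt_kn; clear; lia.
- by rewrite yE iterSr /first_return /entry -iterD subnK.
by exists m.+1; rewrite -iterSr.
Qed.

End FirstReturn.

Lemma perm_closed_sym (T : finType) (p : {perm T}) (B : pred T) :
  (forall x, B x -> B (p x)) -> forall x, B (p x) = B x.
Proof.
move=> clB x; apply/idP/idP=> [Bpx|]; last exact: clB.
have: B (iter (#[p]%g).-1 p (p x)) by elim: (#[p]%g).-1 => //= k; apply: clB.
by rewrite -iterSr prednK ?order_gt0 // -permX expg_order perm1.
Qed.

(** Closed predicates replace words in the generators: the stabilizer of a set is a group, so it is
    enough that it contains the generators. *)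
Lemma transitive_closed (T : finType) (S : {set {perm T}}) (B : pred T) :
  [transitive <<S>>, on [set: T] | 'P] ->
  (forall s x, s \in S -> B x -> B (s x)) -> forall x y, B x -> B y.
Proof.
move=> trS clB x y Bx.
have: y \in orbit 'P <<S>> x by rewrite (atransP trS) ?inE.
case/orbitP=> a Sa <-.
suff: a \in 'N([set z | B z] | 'P)%g.
  by move=> Na; have := astabs_act x Na; rewrite !inE Bx.
move: a Sa; apply/subsetP; rewrite gen_subG; apply/subsetP=> s Ss.
rewrite !inE; apply/subsetP=> z; rewrite !inE /=; exact: clB.
Qed.

Lemma closed_transitive (T : finType) (S : {set {perm T}}) (x0 : T) :
  (forall B : pred T, (forall s x, s \in S -> B x -> B (s x)) ->
     forall x y, B x -> B y) ->
  [transitive <<S>>, on [set: T] | 'P].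
Proof.
move=> H; apply/imsetP; exists x0; first by rewrite inE.
apply/esym/setP=> y; rewrite [RHS]inE.
apply: (H (mem (orbit 'P <<S>> x0)) _ x0); last exact: orbit_refl.
move=> s x Ss /orbitP[a Sa <-]; apply/orbitP; exists (a * s)%g.
  by rewrite groupM // mem_gen.
by rewrite /= /aperm permM.
Qed.

Lemma iter_closed (T : Type) (f : T -> T) (B : T -> Prop) :
  (forall x, B x -> B (f x)) -> forall n x, B x -> B (iter n f x).
Proof. by move=> H n x Bx; elim: n => //= n; apply: H. Qed.

(* A family of ticks: the tick [y] is the one of rank [K y] on the edge [D y];
   each edge [x] satisfying [N] carries [w x] of them. *)
Lemma sum_ticks (T I : finType) (w : T -> nat) (N P : pred T)
    (D : I -> T) (K : I -> nat) :
  (forall y, N (D y)) -> (forall y, K y < w (D y)) ->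
  (forall y y', D y = D y' -> K y = K y' -> y = y') ->
  (forall x k, N x -> k < w x -> exists2 y, D y = x & K y = k) ->
  \sum_(x | N x && P x) w x = #|[set y | P (D y)]|.
Proof.
move=> ND ltK inj sur.
rewrite -sum1_card (partition_big D (fun x => N x && P x)) /=; last first.
  by move=> y; rewrite inE ND.
apply: eq_bigr => x /andP[Nx Px].
rewrite (eq_bigl (mem [set y | D y == x])); last first.
  by move=> y; rewrite !inE; case: eqP => [->|]; rewrite ?Px ?andbF.
rewrite sum1_card cardE -(size_map K) -(size_iota 0 (w x)).
apply/perm_size/uniq_perm; rewrite ?iota_uniq ?map_inj_in_uniq ?enum_uniq //.
  by move=> y y'; rewrite !mem_enum !inE => /eqP E /eqP E'; apply: inj; rewrite E.
move=> k; rewrite mem_iota add0n /=; apply/idP/mapP.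
  by move=> /(sur x k Nx)[y Dy Ky]; exists y => //; rewrite mem_enum inE Dy.
by case=> y; rewrite mem_enum inE => /eqP <- ->.
Qed.

Lemma mem_porbit_morph (T U : finType) (f : T -> U) (p : {perm T}) (q : {perm U}) :
  injective f -> (forall x, f (p x) = q (f x)) ->
  forall x y, (f y \in porbit q (f x)) = (y \in porbit p x).
Proof.
move=> inj morph x y.
have E k : f ((p ^+ k)%g x) = (q ^+ k)%g (f x).
  by rewrite !permX; elim: k => //= k <-.
apply/porbitP/porbitP=> [] [k H]; exists k; last by rewrite H E.
by apply: inj; rewrite E.
Qed.

Lemma porbit_induction (T : finType) (p : {perm T}) (B : T -> Prop) (x : T) :
  B x -> (forall y, B y -> B (p y)) -> forall y, y \in porbit p x -> B y.
Proof. by move=> Bx clB y /porbitP[k ->]; rewrite permX; apply: iter_closed. Qed.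

(** * Turning at the vertices *)

Section Bicolored.

Variable G : bicolored_graph.

Lemma turn_leftE (x : G) : turn_left G x = (rot G)^-1%g (opp G x).
Proof. by rewrite permM. Qed.

Lemma turn_rightE (x : G) : turn_right G x = rot G (opp G x).
Proof. by rewrite permM. Qed.

Lemma natural_opp (x : G) : natural (opp G x) = ~~ natural x.
Proof. exact: edge_separates. Qed.

Lemma natural_left (x : G) : natural (turn_left G x) = natural x.
Proof.
by rewrite /natural /face_of (porbit_eq (porbit_next _ x)).
Qed.

(** Traveling along the edge of [rot x] towards the vertex and turning left leads onto [x] along the
    same face; hence outgoing and incoming ends alternate. *)
Lemma natural_rot (x : G) : natural (rot G x) = ~~ natural x.
Proof.
rewrite -[rot G x](oppK (r := G)) natural_opp; congr (~~ _).
by rewrite -natural_left turn_leftE oppK permK.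
Qed.

Lemma natural_right (x : G) : natural (turn_right G x) = natural x.
Proof. by rewrite turn_rightE natural_rot natural_opp negbK. Qed.

End Bicolored.

Section Vertices.

Variables (m n r : nat) (G : mnr_graph m n r).

Lemma vertex_exists (x : G) : exists v, x \in vertex G v.
Proof.
have [_ im] := vertexP G.
have: porbit (rot G) x \in vertices G by apply: imset_f.
by rewrite -im => /imsetP[v _ E]; exists v; rewrite -E porbit_id.
Qed.

Definition vtx (x : G) : 'I_r := xchoose (vertex_exists x).

Lemma vertexE v : exists x, vertex G v = porbit (rot G) x.
Proof.
have [_ im] := vertexP G.
have: vertex G v \in vertices G by rewrite -im imset_f.
by case/imsetP=> x _ ->; exists x.
Qed.

Lemma vertex_vtx x : vertex G (vtx x) = porbit (rot G) x.
Proof.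
have [y E] := vertexE (vtx x); have := xchooseP (vertex_exists x).
by rewrite -/(vtx x) E => /porbit_eq.
Qed.

Lemma mem_vertex x v : (x \in vertex G v) = (vtx x == v).
Proof.
apply/idP/eqP=> [|<-]; last by rewrite vertex_vtx porbit_id.
have [y E] := vertexE v; rewrite E => /porbit_eq E'.
by have [inj _] := vertexP G; apply: inj; rewrite vertex_vtx E' E.
Qed.

Lemma vtx_rot x : vtx (rot G x) = vtx x.
Proof.
apply/eqP; rewrite -mem_vertex vertex_vtx.
exact: porbit_next.
Qed.

Lemma vtx_rotV x : vtx ((rot G)^-1%g x) = vtx x.
Proof. by rewrite -vtx_rot permKV. Qed.

Lemma card_vertex x : #|porbit (rot G) x| = 4.
Proof. by apply: (@four_valent _ _ _ G); apply: imset_f. Qed.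

Lemma rot4 x : rot G (rot G (rot G (rot G x))) = x.
Proof. by have := iter_porbit (rot G) x; rewrite card_vertex. Qed.

Lemma rot2_neq x : rot G (rot G x) != x.
Proof.
have := uniq_traject_porbit (rot G) x; rewrite card_vertex /= !inE !negb_or.
by case/andP=> /and3P[_ H _] _; rewrite eq_sym.
Qed.

Lemma natural_vertex x y : natural x -> natural y -> vtx x = vtx y ->
  y = x \/ y = rot G (rot G x).
Proof.
move=> nx ny E.
have: y \in porbit (rot G) x by rewrite -vertex_vtx mem_vertex E.
rewrite porbit_traject card_vertex /= !inE.
case/or4P=> /eqP yE; [by left| |by right|]; move: ny;
  by rewrite yE !natural_rot nx.
Qed.

Lemma exists_natural v : exists2 x, natural x & vtx x = v.
Proof.
have [x E] := vertexE v.
have vx : vtx x = v by apply/eqP; rewrite -mem_vertex E porbit_id.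
case nx: (natural x); first by exists x.
by exists (rot G x); rewrite ?natural_rot ?nx ?vtx_rot.
Qed.

End Vertices.

(** * Paths without tick marks *)

Section Turns.

Variables (g m n : nat) (mu : m.-tuple nat) (nu : n.-tuple nat).
Variable G : hurwitz_graph g mu nu.
Local Notation r := (num_branch g m n).

(** Labels are levels plus one, so a label greater than [s] is a level at least [s]. *)
Lemma turnE s (x : G) :
  turn s x = if s <= vtx (opp G x) then turn_left G x else turn_right G x.
Proof.
rewrite /turn; congr (if _ then _ else _).
apply/existsP/idP=> [[v]|le].
  by rewrite mem_vertex => /andP[/eqP ->].
by exists (vtx (opp G x)); rewrite mem_vertex eqxx.
Qed.

Lemma vtx_turn s (x : G) : vtx (turn s x) = vtx (opp G x).
Proof.
by rewrite turnE; case: ifP; rewrite ?turn_leftE ?turn_rightE ?vtx_rot ?vtx_rotV.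
Qed.

Lemma natural_turn s (x : G) : natural (turn s x) = natural x.
Proof. by rewrite turnE; case: ifP; rewrite ?natural_left ?natural_right. Qed.

(** The result starts at the vertex that was reached, so it reveals which of the two injective rules
    was applied. *)
Lemma turn_inj s : injective (@turn _ _ _ _ _ G s).
Proof.
move=> x y E; have E' := congr1 (@vtx _ _ _ G) E; rewrite !vtx_turn in E'.
by move: E; rewrite !turnE E'; case: ifP => _; apply: perm_inj.
Qed.

Definition turn_perm s : {perm G} := perm (@turn_inj s).

Lemma turn_permE s x : turn_perm s x = turn s x.
Proof. exact: permE. Qed.

Lemma turn_perm0 : turn_perm 0 = turn_left G.
Proof. by apply/permP=> x; rewrite turn_permE turnE. Qed.

Lemma turn_perm_last : turn_perm r = turn_right G.
Proof. by apply/permP=> x; rewrite turn_permE turnE leqNgt ltn_ord. Qed.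

Lemma weight0_vtx s (x : G) : natural x -> weight x = 0 -> vtx x < vtx (turn s x).
Proof.
move=> nx w0; rewrite vtx_turn ltnNge; apply/negP=> le.
have := @weight_positive _ _ _ _ _ G x (vtx x) (vtx (opp G x)) nx.
by rewrite !mem_vertex !eqxx w0 => /(_ isT isT le).
Qed.

Local Notation heavy := (fun x : G => 0 < weight x).

(** Downward induction on levels. Edges of weight 0 go up, so paths without tick marks can be
    followed this way. *)
Lemma rank_ind (P : G -> Prop) :
  (forall x, natural x ->
     (forall y, natural y -> vtx x < vtx y -> P y) -> P x) ->
  forall x, natural x -> P x.
Proof.
move=> IH x; have [k] := ubnP (r - vtx x); elim: k x => // k IHk x ltk nx.
apply: IH => // y ny lt; apply: IHk => //.
by have := ltn_ord (vtx y); have := ltn_ord (vtx x); lia.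
Qed.

Lemma meets_heavy s (x : G) : natural x -> meets (turn_perm s) heavy x.
Proof.
move: x; apply: rank_ind => x nx IH.
case wx: (weight x) => [|w]; last by exists 0; rewrite /= wx.
apply: meets_next; rewrite turn_permE.
by apply: IH; rewrite ?natural_turn ?weight0_vtx.
Qed.

Definition first_edge s (x : G) : G := entry (turn_perm s) heavy x.

Lemma first_edge_heavy s x : natural x -> 0 < weight (first_edge s x).
Proof. by move=> nx; have [] := hitP (meets_heavy s nx). Qed.

Lemma first_edge_id s (x : G) : 0 < weight x -> first_edge s x = x.
Proof. by move=> wx; rewrite /first_edge entry_id. Qed.

Lemma first_edge_turn s x : natural x -> weight x = 0 ->
  first_edge s (turn s x) = first_edge s x.
Proof.
move=> nx wx; rewrite -turn_permE /first_edge entry_next ?wx //.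
exact: meets_heavy.
Qed.

Lemma natural_iter s k (x : G) : natural x -> natural (iter k (turn_perm s) x).
Proof. by move=> nx; elim: k => //= k IH; rewrite turn_permE natural_turn. Qed.

Lemma natural_first_edge s x : natural x -> natural (first_edge s x).
Proof. exact: natural_iter. Qed.

Lemma vtx_iter s k x : natural x ->
  (forall j, j < k -> ~~ heavy (iter j (turn_perm s) x)) ->
  vtx x + k <= vtx (iter k (turn_perm s) x).
Proof.
move=> nx; elim: k => [|k IH] H; first by rewrite addn0.
have := IH (fun j lt => H j (ltnW lt)).
have := @weight0_vtx s _ (natural_iter s k nx).
have := H k (ltnSn k); rewrite -eqn0Ngt => /eqP -> /(_ erefl).
by rewrite iterS turn_permE addnS => lt le; apply: leq_ltn_trans le lt.
Qed.

Lemma first_edge_vtx s x : natural x -> vtx x <= vtx (first_edge s x).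
Proof.
move=> nx; have [_ H] := hitP (meets_heavy s nx).
by have := vtx_iter nx H; apply: leq_trans; apply: leq_addr.
Qed.

(* Past the vertex of [x] a path only meets larger vertices, where the rules
   up to that vertex agree. *)
Lemma first_edge0 s x : natural x -> s <= (vtx x).+1 ->
  first_edge s x = first_edge 0 x.
Proof.
move: x; apply: rank_ind => x nx IH les.
case wx: (weight x) => [|w]; last by rewrite !first_edge_id ?wx.
rewrite -(first_edge_turn s nx wx) -(first_edge_turn 0 nx wx).
have := weight0_vtx s nx wx; rewrite vtx_turn => lt.
have -> : turn s x = turn 0 x by rewrite !turnE leq0n (leq_trans les).
by apply: IH; rewrite ?natural_turn // ?vtx_turn // (leq_trans les) // ltnW.
Qed.

(** Levels strictly increase along edges of weight 0, so the comparison of levels decides which path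
    joins the other. The edge [z] before [y] is kept because injectivity of [turn s] can identify it
    later. *)
Lemma first_edge_confluent s x y : natural x -> natural y ->
  first_edge s x = first_edge s y -> vtx x <= vtx y ->
  x = y \/ exists2 z, [/\ natural z, weight z = 0 & vtx x <= vtx z] &
                      y = turn s z.
Proof.
move=> nx ny E le.
have forward u v : natural u -> natural v -> (exists2 k, v = iter k (turn_perm s) u &
      forall j, j < k -> ~~ heavy (iter j (turn_perm s) u)) ->
    u = v \/ vtx u < vtx v /\ exists2 z,
      [/\ natural z, weight z = 0 & vtx u <= vtx z] & v = turn s z.
  move=> nu_ nv [[|k] -> H]; [by left | right; split].
    by have := vtx_iter nu_ H; apply: leq_trans; rewrite addnS ltnS leq_addr.
  exists (iter k (turn_perm s) u); last by rewrite /= turn_permE.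
  split; [exact: natural_iter | | ].
    by have := H k (ltnSn k); rewrite -eqn0Ngt => /eqP.
  have := vtx_iter nu_ (fun j lt => H j (ltnW lt)).
  by apply: leq_trans; apply: leq_addr.
case: (entry_confluent (meets_heavy s nx) (meets_heavy s ny) E) => H.
  by case: (forward _ _ nx ny H) => [|[_]]; [left|right].
case: (forward _ _ ny nx H) => [->|[lt _]]; first by left.
by rewrite leqNgt lt in le.
Qed.

Lemma first_edge_inj s x y : natural x -> natural y ->
  0 < weight x -> 0 < weight y ->
  first_edge s (turn s x) = first_edge s (turn s y) -> x = y.
Proof.
move=> _ _ wx wy; rewrite -!turn_permE.
exact: (@first_return_inj _ (turn_perm s) heavy).
Qed.

End Turns.

(** * Traveling between labeled tick marks *)

Section Ticks.

Variables (g m n : nat) (mu : m.-tuple nat) (nu : n.-tuple nat).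
Variable G : hurwitz_graph g mu nu.
Local Notation r := (num_branch g m n).

Lemma tick_eq (t u : tick G) :
  tick_dart t = tick_dart u -> tick_pos t = tick_pos u -> t = u.
Proof.
case: t u => [[x k] nx] [[y l] ny]; rewrite /tick_dart /tick_pos /=.
by move=> E; case: y / E l ny => l ny E; apply/val_inj; rewrite (val_inj E).
Qed.

Lemma tick_exists (x : G) k : natural x -> k < weight x ->
  exists2 t : tick G, tick_dart t = x & tick_pos t = k.
Proof.
move=> nx ltk.
by exists (exist (fun t => natural (tag t))
             (Tagged (fun x : G => 'I_(weight x)) (Ordinal ltk)) nx).
Qed.

Lemma tick_natural (t : tick G) : natural (tick_dart t).
Proof. by case: t. Qed.

Lemma tick_pos_lt (t : tick G) : tick_pos t < weight (tick_dart t).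
Proof. exact: ltn_ord. Qed.

(** Replaces the inductive relation by a function, from which existence and uniqueness of the next
    tick mark follow. *)
Lemma first_tickP s x (t : tick G) : natural x ->
  first_tick s x t <-> tick_pos t = 0 /\ tick_dart t = first_edge s x.
Proof.
move=> nx; split.
  move=> H; elim: H nx => {x t} [t|x t wx _ IH nx].
    move=> t0 _; split; rewrite ?first_edge_id //.
    by have := tick_pos_lt t; rewrite t0.
  have [|-> ->] := IH; first by rewrite natural_turn.
  by rewrite first_edge_turn.
case=> t0; move: x nx; apply: rank_ind => x nx IH E.
case wx: (weight x) => [|w]; last first.
  by rewrite -(@first_edge_id _ _ _ _ _ G s x) ?wx // -E; left.
right=> //; apply: IH; rewrite ?natural_turn ?weight0_vtx //.
by rewrite first_edge_turn.
Qed.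

Lemma next_tickP s (t u : tick G) : next_tick s t u <->
  if (tick_pos t).+1 < weight (tick_dart t)
  then tick_dart u = tick_dart t /\ tick_pos u = (tick_pos t).+1
  else tick_dart u = first_edge s (turn s (tick_dart t)) /\ tick_pos u = 0.
Proof.
have nt := tick_natural t; have nu_ : natural (turn s (tick_dart t)).
  by rewrite natural_turn.
have ltt := tick_pos_lt t; have ltu := tick_pos_lt u.
split.
  case=> [[E E']|[E /(first_tickP _ _ nu_)[-> ->]]]; last by rewrite E ltnn.
  by rewrite -E' -E ltu.
case: ltnP => [_ [E E']|le [E E']]; [by left | right].
by split; [apply/eqP; rewrite eqn_leq le ltt | apply/(first_tickP _ _ nu_)].
Qed.

End Ticks.

(** * The travel permutations and the change of turning rule *)

Section Labels.

Variables (g d m n : nat) (mu : m.-tuple nat) (nu : n.-tuple nat).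
Hypothesis d_gt0 : 0 < d.
Variables (G : hurwitz_graph g mu nu) (lab : 'I_d -> tick G).
Hypothesis lab_bij : bijective lab.
Local Notation r := (num_branch g m n).

Definition edge_of (k : 'I_d) : G := tick_dart (lab k).
Definition rank_of (k : 'I_d) : nat := tick_pos (lab k).

Lemma natural_edge k : natural (edge_of k).
Proof. exact: tick_natural. Qed.

Lemma rank_lt k : rank_of k < weight (edge_of k).
Proof. exact: tick_pos_lt. Qed.

Lemma edge_weight k : 0 < weight (edge_of k).
Proof. by apply: leq_ltn_trans (rank_lt k). Qed.

Lemma edge_rank_inj k l : edge_of k = edge_of l -> rank_of k = rank_of l -> k = l.
Proof. by move=> E E'; apply: (bij_inj lab_bij); apply: tick_eq. Qed.

Lemma edge_rank_sur (x : G) j : natural x -> j < weight x ->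
  exists2 k, edge_of k = x & rank_of k = j.
Proof.
move=> nx lt; have [t <- <-] := tick_exists nx lt.
by have [inv _ invK] := lab_bij; exists (inv t); rewrite /edge_of /rank_of invK.
Qed.

Definition tick_at (x : G) (j : nat) : 'I_d :=
  odflt (Ordinal d_gt0) [pick k | (edge_of k == x) && (rank_of k == j)].

Lemma tick_atP x j : natural x -> j < weight x ->
  edge_of (tick_at x j) = x /\ rank_of (tick_at x j) = j.
Proof.
move=> nx lt; rewrite /tick_at; case: pickP => [k /andP[/eqP -> /eqP ->] //|].
by have [k <- <-] := edge_rank_sur nx lt => /(_ k); rewrite !eqxx.
Qed.

Lemma tick_at_id k : tick_at (edge_of k) (rank_of k) = k.
Proof.
have [E E'] := tick_atP (natural_edge k) (rank_lt k).
exact: edge_rank_inj.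
Qed.

Definition first_label s (x : G) : 'I_d := tick_at (first_edge s x) 0.

Lemma first_labelP s x : natural x ->
  edge_of (first_label s x) = first_edge s x /\ rank_of (first_label s x) = 0.
Proof.
by move=> nx; apply: tick_atP; [exact: natural_first_edge|exact: first_edge_heavy].
Qed.

Definition travel_fun s (k : 'I_d) : 'I_d :=
  if (rank_of k).+1 < weight (edge_of k) then tick_at (edge_of k) (rank_of k).+1
  else first_label s (turn s (edge_of k)).

Lemma next_tick_labels s k l : next_tick s (lab k) (lab l) <->
  if (rank_of k).+1 < weight (edge_of k)
  then edge_of l = edge_of k /\ rank_of l = (rank_of k).+1
  else edge_of l = first_edge s (turn s (edge_of k)) /\ rank_of l = 0.
Proof. exact: next_tickP. Qed.

Lemma next_label s k l : next_tick s (lab k) (lab l) <-> l = travel_fun s k.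
Proof.
have nt : natural (turn s (edge_of k)) by rewrite natural_turn natural_edge.
rewrite next_tick_labels /travel_fun; case: ifP => [lt|_].
  have [E1 E2] := tick_atP (natural_edge k) lt.
  by split=> [[E E']|->] //; apply: edge_rank_inj; rewrite ?E ?E' ?E1 ?E2.
have [E1 E2] := first_labelP s nt.
by split=> [[E E']|->] //; apply: edge_rank_inj; rewrite ?E ?E' ?E1 ?E2.
Qed.

(** The rank of the image tells whether an edge was left: if positive, the mark came from the same
    edge; if 0, first returns to edges with tick marks are injective. *)
Lemma travel_fun_inj s : injective (travel_fun s).
Proof.
move=> k l E.
have [Hk Hl] : next_tick s (lab k) (lab (travel_fun s k)) /\
               next_tick s (lab l) (lab (travel_fun s k)).
  by split; apply/next_label.
move/next_tick_labels: Hk; move/next_tick_labels: Hl.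
have lk := rank_lt k; have ll := rank_lt l.
have nk := natural_edge k; have nl := natural_edge l.
have wk := edge_weight k; have wl := edge_weight l.
case: ltnP => lel [-> ->]; case: ltnP => lek [E1 E2] //.
- by apply: edge_rank_inj => //; case: E2.
- have E3 := first_edge_inj nl nk wl wk E1.
  apply: edge_rank_inj; rewrite ?E3 //; move: lel lek lk ll; rewrite E3; lia.
Qed.

Definition travel s : {perm 'I_d} := perm (@travel_fun_inj s).

Lemma travelE s k : travel s k = travel_fun s k.
Proof. exact: permE. Qed.

Lemma next_travel s k : next_tick s (lab k) (lab (travel s k)).
Proof. by apply/next_label; rewrite travelE. Qed.

Lemma next_travel_unique s k l : next_tick s (lab k) (lab l) -> l = travel s k.
Proof. by move/next_label; rewrite travelE. Qed.

Lemma first_label_heavy s (x : G) : 0 < weight x -> first_label s x = tick_at x 0.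
Proof. by move=> wx; rewrite /first_label first_edge_id. Qed.

Lemma first_label_turn s x : natural x -> weight x = 0 ->
  first_label s (turn s x) = first_label s x.
Proof. by move=> nx wx; rewrite /first_label first_edge_turn. Qed.

Lemma first_label0 s x : natural x -> s <= (vtx x).+1 ->
  first_label s x = first_label 0 x.
Proof. by move=> nx les; rewrite /first_label first_edge0. Qed.

Lemma first_label_eq s x y : natural x -> natural y ->
  first_label s x = first_label s y -> first_edge s x = first_edge s y.
Proof.
move=> nx ny E; have [<- _] := first_labelP s nx.
by have [<- _] := first_labelP s ny; rewrite E.
Qed.

Lemma iter_travel s x j : natural x -> j < weight x ->
  iter j (travel s) (first_label s x) = tick_at x j.
Proof.
move=> nx; elim: j => [|j IH] lt; first by rewrite first_label_heavy.
rewrite iterS (IH (ltnW lt)) travelE /travel_fun.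
by have [-> ->] := tick_atP nx (ltnW lt); rewrite lt.
Qed.

(** The bridge between turning at vertices and jumping between tick marks: one turn amounts to
    [weight x] jumps, none if the edge is empty. *)
Lemma iter_travel_weight s x : natural x ->
  iter (weight x) (travel s) (first_label s x) = first_label s (turn s x).
Proof.
move=> nx; case wx: (weight x) => [|w] /=; first by rewrite first_label_turn.
have lt : w < weight x by rewrite wx.
rewrite (iter_travel s nx lt) travelE /travel_fun.
by have [-> ->] := tick_atP nx lt; rewrite wx ltnn.
Qed.

(** If the two paths merged, one of the edges would follow an edge of weight 0 that starts at this
    level or above, and so would start strictly higher. *)
Lemma first_label_neq s x y : natural x -> natural y -> vtx x = vtx y -> x != y ->
  first_label s x != first_label s y.
Proof.
move=> nx ny E ne; apply/eqP=> /(first_label_eq nx ny) E'.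
have le_xy : vtx x <= vtx y by rewrite E.
case: (first_edge_confluent nx ny E' le_xy) => [xy|[z [nz wz le] yE]].
  by rewrite xy eqxx in ne.
by have := weight0_vtx s nz wz; rewrite -yE ltnNge -E le.
Qed.

(* The paths following the rules of two consecutive indices only separate at
   the vertex [vtx b], where they leave along its two outgoing edges. *)
Lemma first_label_turnS b x : natural b -> natural x ->
    (vtx x < vtx b) || (0 < weight x) ->
  first_label (vtx b).+1 (turn (vtx b).+1 x) =
  tperm (first_label 0 b) (first_label 0 (rot G (rot G b)))
    (first_label (vtx b) (turn (vtx b) x)).
Proof.
set b' := rot G (rot G b); set i : nat := vtx b => nb.
have nb' : natural b' by rewrite !natural_rot nb.
have vb' : vtx b' = vtx b by rewrite !vtx_rot.
(* Paths that jump over level [i] do not end at an exchanged label: by confluence [y] would be an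
   edge of weight 0 starting at level [i] or above. *)
have fix_far c y : natural c -> vtx c = vtx b -> natural y -> 
    (i < vtx (opp G y)) -> (vtx y < i) || (0 < weight y) ->
    first_label 0 c != first_label 0 (turn i y).
  move=> nc vc ny lty H.
  have nty : natural (turn i y) by rewrite natural_turn.
  apply/eqP=> /(first_label_eq nc nty) E.
  have tyE : turn i y = turn 0 y by rewrite !turnE leq0n (ltnW lty).
  have lev : vtx c <= vtx (turn i y) by rewrite vtx_turn vc ltnW.
  case: (first_edge_confluent nc nty E lev) => [cE|[z [nz wz le]]].
    by move: lty; rewrite -(vtx_turn i y) -cE vc /i ltnn.
  by rewrite tyE => /turn_inj yz; move: H; rewrite yz wz /= orbF ltnNge -/i /i -vc le.
(* Paths to the first tick mark only go up, so from level [i] they miss the edges that start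
   below. *)
have fix_near c y : natural c -> vtx c = vtx b -> natural y -> 0 < weight y ->
    vtx y < i -> first_label 0 c != tick_at y 0.
  move=> nc vc ny wy lty; rewrite -(first_label_heavy 0 wy).
  apply/eqP=> /(first_label_eq nc ny) E.
  by have := first_edge_vtx 0 nc; rewrite E first_edge_id // leqNgt vc lty.
(* Below level [i] both rules turn right and the claim is inherited; above it both turn left and the
   label is fixed; at level [i] they take the two different outgoing edges. *)
have step y : natural y -> (vtx y < i) || (0 < weight y) ->
    (vtx (opp G y) < i -> first_label i.+1 (turn i y) =
       tperm (first_label 0 b) (first_label 0 b') (first_label i (turn i y))) ->
    first_label i.+1 (turn i.+1 y) =
      tperm (first_label 0 b) (first_label 0 b') (first_label i (turn i y)).
  move=> {x} ny H IH; case: (ltngtP (vtx (opp G y)) i) => lt.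
  - by rewrite -IH // !turnE ltnNge (ltnW lt) leqNgt lt.
  - have tE : turn i.+1 y = turn i y by rewrite !turnE lt (ltnW lt).
    have nt : natural (turn i y) by rewrite natural_turn.
    by rewrite tE !(first_label0 nt) ?vtx_turn ?tpermD ?fix_far // ltnW // ltnW.
  have nt : natural (turn i y) by rewrite natural_turn.
  have nt' : natural (turn i.+1 y) by rewrite natural_turn.
  have vt : vtx (turn i y) = vtx b by rewrite vtx_turn; apply: val_inj.
  have vt' : vtx (turn i.+1 y) = vtx b by rewrite vtx_turn; apply: val_inj.
  rewrite !first_label0 ?vt ?vt' //.
  have -> : turn i.+1 y = rot G (rot G (turn i y)).
    by rewrite !turnE lt leqnn ltnn turn_leftE turn_rightE permKV.
  case: (natural_vertex nb nt (esym vt)) => ->; first by rewrite tpermL.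
  by rewrite rot4 tpermR.
have flip z : natural z -> vtx z < i -> first_label i.+1 z =
    tperm (first_label 0 b) (first_label 0 b') (first_label i z).
  move: z; apply: rank_ind => z nz IH ltz; case wz: (weight z) => [|w].
    rewrite -(first_label_turn i.+1 nz wz) -(first_label_turn i nz wz).
    apply: step; rewrite ?ltz // => lt.
    by apply: IH; rewrite ?natural_turn ?weight0_vtx // vtx_turn.
  have wz' : 0 < weight z by rewrite wz.
  by rewrite !(first_label_heavy _ wz') tpermD //; apply: fix_near.
by move=> nx H; apply: step => // lt; apply: flip; rewrite ?natural_turn ?vtx_turn.
Qed.
End Labels.

(** * From Hurwitz ribbon graphs to monodromy sequences *)

Section Faces.

Variable G : bicolored_graph.

Lemma natural_mem_white (F : {set G}) x : F \in white G -> x \in F -> natural x.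
Proof.
move=> wF; have /imsetP[z _ FE] := subsetP (white_faces G) F wF.
by rewrite FE => /porbit_eq E; rewrite /natural /face_of E -FE.
Qed.

Lemma natural_mem_gray (F : {set G}) x : F \in gray G -> x \in F -> ~~ natural x.
Proof.
rewrite inE => /andP[nwF /imsetP[z _ FE]].
by rewrite FE => /porbit_eq E; rewrite /natural /face_of E -FE.
Qed.

Lemma face_eq (F : {set G}) x : F \in faces G -> x \in F -> F = face_of x.
Proof. by case/imsetP=> z _ -> /porbit_eq <-. Qed.

Lemma face_of_gray (x : G) : ~~ natural x -> face_of x \in gray G.
Proof. by move=> nx; rewrite inE nx imset_f. Qed.

(** Orbits of [turn_left] keep their face on the left, hence follow a gray face against the natural
    direction; [opp] conjugates [turn_right] to the inverse of [turn_left]. *)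
Lemma opp_porbit (x y : G) :
  (opp G y \in porbit (turn_left G) (opp G x)) = (y \in porbit (turn_right G) x).
Proof.
rewrite -porbitV; apply: mem_porbit_morph => [|z]; first exact: perm_inj.
apply: (@perm_inj _ (turn_left G)); rewrite permKV turn_leftE turn_rightE oppK.
by rewrite permK.
Qed.

End Faces.

Section GraphToMonodromy.

Variables (g d m n : nat) (mu : m.-tuple nat) (nu : n.-tuple nat).
Hypothesis d_gt0 : 0 < d.
Variables (G : hurwitz_graph g mu nu) (lab : 'I_d -> tick G).
Hypothesis lab_bij : bijective lab.
Local Notation r := (num_branch g m n).
Local Notation edge_of := (edge_of lab).
Local Notation rank_of := (rank_of lab).
Local Notation tick_at := (tick_at d_gt0 lab).
Local Notation first_label := (first_label d_gt0 lab).
Local Notation travel := (travel d_gt0 lab_bij).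

Lemma travelS (b : G) k : natural b -> travel (vtx b).+1 k =
  tperm (first_label 0 b) (first_label 0 (rot G (rot G b))) (travel (vtx b) k).
Proof.
move=> nb; rewrite !travelE /travel_fun.
have nb' : natural (rot G (rot G b)) by rewrite !natural_rot nb.
case: ifP => [lt|_]; last first.
  by rewrite first_label_turnS // ?natural_edge // edge_weight orbT.
(* Inside an edge the next tick mark has positive rank, whereas the exchanged ones have rank 0. *)
have fix_c c : natural c -> first_label 0 c != tick_at (edge_of k) (rank_of k).+1.
  move=> nc; apply/eqP=> E; have [_] := first_labelP d_gt0 lab_bij 0 nc.
  by rewrite E; have [_ ->] := tick_atP d_gt0 lab_bij (natural_edge lab k) lt.
by rewrite tpermD ?fix_c.
Qed.

Lemma edge_travel_porbit s k :
  edge_of (travel s k) \in porbit (turn_perm G s) (edge_of k).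
Proof.
have := next_travel d_gt0 lab_bij s k; move/next_tick_labels.
case: ifP => _ [-> _]; first exact: porbit_id.
apply: porbit_mem_trans (porbit_next _ _) _; rewrite turn_permE.
exact: entry_porbit.
Qed.

Lemma tick_at_porbit s x j : natural x -> j < weight x ->
  tick_at x j \in porbit (travel s) (first_label s x).
Proof.
by move=> nx lt; rewrite -(iter_travel d_gt0 lab_bij s nx lt) -permX mem_porbit.
Qed.

Lemma first_label_porbit s x y : natural x -> y \in porbit (turn_perm G s) x ->
  first_label s y \in porbit (travel s) (first_label s x).
Proof.
move=> nx /porbitP[k ->]; rewrite permX; elim: k => [|k IH]; first exact: porbit_id.
apply: porbit_mem_trans IH _; rewrite iterS turn_permE.
rewrite -(iter_travel_weight d_gt0 lab_bij) ?natural_iter //.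
by rewrite -permX mem_porbit.
Qed.

(** With [s = 0] the orbits on edges are the white faces, with [s = r] the gray ones, so both kinds
    of faces are matched with cycles at once. *)
Lemma travel_porbit s k l :
  (l \in porbit (travel s) k) = (edge_of l \in porbit (turn_perm G s) (edge_of k)).
Proof.
apply/idP/idP.
  apply: (porbit_induction (B := fun l => edge_of l \in _)) => [|y IH].
    exact: porbit_id.
  exact: porbit_mem_trans IH (edge_travel_porbit _ _).
have H y : y \in porbit (travel s) (first_label s (edge_of y)).
  rewrite -{1}(tick_at_id d_gt0 lab_bij y) tick_at_porbit //.
    exact: natural_edge.
  exact: rank_lt.
move/(first_label_porbit (natural_edge _ _)) => Hkl.
have Hk : first_label s (edge_of k) \in porbit (travel s) k.
  by rewrite porbit_sym; apply: H.
exact: porbit_mem_trans Hk (porbit_mem_trans Hkl (H l)).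
Qed.

Lemma mem_ticks_white F k : F \in white G ->
  (k \in ticks_on lab F) = (edge_of k \in F).
Proof.
move=> wF; rewrite inE; case: (boolP (opp G _ \in F)); rewrite ?orbF // => H.
by have := natural_mem_white wF H; rewrite natural_opp natural_edge.
Qed.

Lemma mem_ticks_gray F k : F \in gray G ->
  (k \in ticks_on lab F) = (opp G (edge_of k) \in F).
Proof.
move=> wF; rewrite inE; case: (boolP (tick_dart _ \in F)) => //= H.
by have := natural_mem_gray wF H; rewrite natural_edge.
Qed.

Lemma ticks_white F k : F \in white G -> k \in ticks_on lab F ->
  ticks_on lab F = porbit (travel 0) k.
Proof.
move=> wF kF; apply/setP=> l; rewrite travel_porbit turn_perm0 mem_ticks_white //.
move: kF; rewrite mem_ticks_white // => kF.
by rewrite (face_eq (subsetP (white_faces G) _ wF) kF).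
Qed.

Lemma ticks_gray F k : F \in gray G -> k \in ticks_on lab F ->
  ticks_on lab F = porbit (travel r) k.
Proof.
move=> wF kF; apply/setP=> l; rewrite travel_porbit turn_perm_last mem_ticks_gray //.
move: kF; rewrite mem_ticks_gray // => kF.
have fF : F \in faces G by move: wF; rewrite inE => /andP[].
by rewrite (face_eq fF kF) -opp_porbit.
Qed.

(** Without tick marks the levels would increase all the way around the boundary. *)
Lemma ticks_white_nonempty F : F \in white G -> exists k, k \in ticks_on lab F.
Proof.
move=> wF; have fF := subsetP (white_faces G) _ wF.
have /imsetP[x _ FE] := fF; have xF : x \in F by rewrite FE porbit_id.
have nx := natural_mem_white wF xF.
exists (first_label 0 x); rewrite mem_ticks_white //.
have [-> _] := first_labelP d_gt0 lab_bij 0 nx.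
by rewrite FE -turn_perm0; apply: entry_porbit.
Qed.

Lemma ticks_gray_nonempty F : F \in gray G -> exists k, k \in ticks_on lab F.
Proof.
move=> gF; have fF : F \in faces G by move: gF; rewrite inE => /andP[].
have /imsetP[x _ FE] := fF; have xF : x \in F by rewrite FE porbit_id.
have nx : natural (opp G x) by rewrite natural_opp (natural_mem_gray gF xF).
exists (first_label r (opp G x)); rewrite mem_ticks_gray //.
have [-> _] := first_labelP d_gt0 lab_bij r nx.
have := opp_porbit (opp G x) (first_edge r (opp G x)); rewrite oppK FE => ->.
by rewrite -turn_perm_last; apply: entry_porbit.
Qed.

Lemma ticks_labeling (W : {set {set G}}) s :
  (forall F, F \in W -> exists k, k \in ticks_on lab F) ->
  (forall F k, F \in W -> k \in ticks_on lab F ->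
     ticks_on lab F = porbit (travel s) k) ->
  (forall k, exists2 F, F \in W & k \in ticks_on lab F) ->
  (forall F F' k, F \in W -> F' \in W -> k \in ticks_on lab F ->
     k \in ticks_on lab F' -> F = F') ->
  {in W &, injective (ticks_on lab)} /\ ticks_on lab @: W = porbits (travel s).
Proof.
move=> ne orb cov disj; split.
  move=> F F' WF WF' E; have [k kF] := ne F WF.
  by apply: (disj F F' k) => //; rewrite -E.
apply/setP=> C; apply/imsetP/imsetP=> [[F WF ->]|[k _ ->]].
  by have [k kF] := ne F WF; exists k; last exact: orb.
by have [F WF kF] := cov k; exists F; last exact/esym/orb.
Qed.

Lemma ticks_white_labeling :
  {in white G &, injective (ticks_on lab)} /\
  ticks_on lab @: white G = porbits (travel 0).
Proof.
apply: ticks_labeling => [||k|F F' k wF wF'].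
- exact: ticks_white_nonempty.
- exact: ticks_white.
- have wF : face_of (edge_of k) \in white G by apply: natural_edge.
  by exists (face_of (edge_of k)); rewrite ?mem_ticks_white ?porbit_id.
rewrite !mem_ticks_white // => kF kF'.
have fw := subsetP (white_faces G).
by rewrite (face_eq (fw _ wF) kF) (face_eq (fw _ wF') kF').
Qed.

Lemma ticks_gray_labeling :
  {in gray G &, injective (ticks_on lab)} /\
  ticks_on lab @: gray G = porbits (travel r).
Proof.
apply: ticks_labeling => [||k|F F' k wF wF'].
- exact: ticks_gray_nonempty.
- exact: ticks_gray.
- have wF : face_of (opp G (edge_of k)) \in gray G.
    by apply: face_of_gray; rewrite natural_opp natural_edge.
  by exists (face_of (opp G (edge_of k))); rewrite ?mem_ticks_gray ?porbit_id.
rewrite !mem_ticks_gray // => kF kF'.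
have fg A : A \in gray G -> A \in faces G by rewrite inE => /andP[].
by rewrite (face_eq (fg _ wF) kF) (face_eq (fg _ wF') kF').
Qed.

Lemma card_ticks_white i : #|ticks_on lab (white_face G i)| = tnth mu i.
Proof.
have wF : white_face G i \in white G.
  by have [_ <-] := white_faceP G; apply: imset_f.
rewrite -(white_balanced G) (eq_bigl (fun x => natural x && (x \in white_face G i))).
  rewrite (@sum_ticks _ _ _ _ _ edge_of rank_of).
  - by apply: eq_card => k; rewrite mem_ticks_white // inE.
  - exact: natural_edge.
  - exact: rank_lt.
  - exact: edge_rank_inj.
  - exact: edge_rank_sur.
move=> x; apply/idP/andP=> [xF|[]//].
by split=> //; apply: natural_mem_white wF xF.
Qed.

Lemma card_ticks_gray j : #|ticks_on lab (gray_face G j)| = tnth nu j.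
Proof.
have wF : gray_face G j \in gray G.
  by have [_ <-] := gray_faceP G; apply: imset_f.
rewrite -(gray_balanced G) (reindex_inj (@perm_inj _ (opp G))) /=.
rewrite (eq_bigr _ (fun x _ => weight_opp x)).
rewrite (eq_bigl (fun x => natural x && (opp G x \in gray_face G j))).
  rewrite (@sum_ticks _ _ _ _ _ edge_of rank_of).
  - by apply: eq_card => k; rewrite mem_ticks_gray // inE.
  - exact: natural_edge.
  - exact: rank_lt.
  - exact: edge_rank_inj.
  - exact: edge_rank_sur.
move=> x; apply/idP/andP=> [xF|[]//].
by split=> //; rewrite -[natural x]negbK -natural_opp (natural_mem_gray wF xF).
Qed.

Definition travel_seq (i : 'I_r.+1) : {perm 'I_d} := travel i.

Lemma tau_travel (b : G) : natural b -> tau travel_seq (vtx b) =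
  tperm (first_label 0 b) (first_label 0 (rot G (rot G b))).
Proof.
move=> nb; apply/permP=> k; rewrite /tau comp_permE.
by rewrite -[travel_seq (lift _ _)]/(travel (vtx b).+1) travelS // permKV.
Qed.

Lemma tau_travel_transposition i : is_transposition (tau travel_seq i).
Proof.
have [b nb <-] := exists_natural G i; rewrite tau_travel //.
exists (first_label 0 b), (first_label 0 (rot G (rot G b))); split=> //.
by rewrite first_label_neq ?natural_rot ?nb ?vtx_rot // eq_sym rot2_neq.
Qed.

(** A set of labels closed under the generators is pulled back to darts by [first_label 0], where it
    becomes closed under [opp] and [rot]; the graph being connected, it is everything. *)
Lemma travel_seq_transitive :
  [transitive <<travel_seq ord0 |: [set tau travel_seq i | i : 'I_r]>>,
     on [set: 'I_d] | 'P].
Proof.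
apply: (@closed_transitive _ _ (Ordinal d_gt0)) => B clB k l Bk.
have Bt i y : B (tau travel_seq i y) = B y.
  by apply: perm_closed_sym => z; apply: clB; rewrite !inE imset_f ?orbT.
have B0 y : B (travel 0 y) = B y.
  by apply: perm_closed_sym => z; apply: clB; rewrite !inE eqxx.
have Bs s y : s <= r -> B (travel s y) = B y.
  elim: s y => [//|s IH] y lts.
  have [b nb vb] := exists_natural G (Ordinal lts).
  have sE : s = vtx b by rewrite vb.
  by rewrite sE travelS // -tau_travel // Bt -sE IH // ltnW.
(* Passing from [s] to [s.+1] changes a first label at most by the transposition at level [s], which
   preserves [B]. *)
have Bf s x : s <= r -> natural x -> B (first_label s x) = B (first_label 0 x).
  elim: s => [//|s IH] lts nx; rewrite -IH ?(ltnW lts) //.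
  case: (leqP s (vtx x)) => [le|ltx].
    by rewrite !(first_label0 _ _ nx) // ltnW.
  case wx: (weight x) => [|w]; last by rewrite !first_label_heavy ?wx.
  rewrite -(first_label_turn _ _ s nx wx) -(first_label_turn _ _ s.+1 nx wx).
  have [b nb vb] := exists_natural G (Ordinal lts).
  have sE : s = vtx b by rewrite vb.
  by rewrite sE first_label_turnS // -?tau_travel ?Bt // -sE ltx.
have Bturn s x : s <= r -> natural x ->
    B (first_label 0 (turn s x)) = B (first_label 0 x).
  move=> les nx; rewrite -(Bf s) ?natural_turn // -(Bf s x) //.
  rewrite -(iter_travel_weight d_gt0 lab_bij) //.
  by elim: (weight x) => //= w IH; rewrite Bs.
pose C (x : G) := B (first_label 0 (if natural x then x else opp G x)).
have allC x y : C x -> C y.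
  move: x y; apply: (transitive_closed (ribbon_connected G)) => s x.
  rewrite !inE => /orP[] /eqP ->; rewrite /C ?natural_opp ?natural_rot.
    by case: (natural x); rewrite //= oppK.
  (* From a natural dart, [rot] undoes a left turn; from an incoming end it completes a right
     turn. *)
  case nx: (natural x) => /=.
    rewrite -(Bturn 0 (opp G (rot G x))) ?natural_opp ?natural_rot ?nx //.
    by rewrite turnE /= turn_leftE oppK permK.
  rewrite -(Bturn r (opp G x)) ?natural_opp ?nx //.
  by rewrite turnE leqNgt ltn_ord /= turn_rightE oppK.
have BC y : B y = C (edge_of y).
  rewrite /C natural_edge; have ny := natural_edge lab y.
  rewrite -{1}(tick_at_id d_gt0 lab_bij y).
  rewrite -(iter_travel d_gt0 lab_bij 0 ny (rank_lt lab y)).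
  by elim: (rank_of y) => //= w IH; rewrite Bs.
by rewrite BC; apply: allC (_ : C (edge_of k)); rewrite -BC.
Qed.

Lemma white_cycles : is_labeling (porbits (travel_seq ord0))
  (fun i => ticks_on lab (white_face G i)).
Proof.
have [inj im] := ticks_white_labeling; have [injw imw] := white_faceP G.
have wF i : white_face G i \in white G by rewrite -imw imset_f.
split; first by move=> i j /(inj _ _ (wF i) (wF j)) /injw.
by rewrite -[porbits _]im -imw -imset_comp.
Qed.

Lemma gray_cycles : is_labeling (porbits (travel_seq ord_max))
  (fun j => ticks_on lab (gray_face G j)).
Proof.
have [inj im] := ticks_gray_labeling; have [injw imw] := gray_faceP G.
have wF i : gray_face G i \in gray G by rewrite -imw imset_f.
split; first by move=> i j /(inj _ _ (wF i) (wF j)) /injw.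
by rewrite -[porbits _]im -imw -imset_comp.
Qed.

Definition monodromy_of : monodromy_sequence g d mu nu :=
  MonodromySequence white_cycles gray_cycles card_ticks_white card_ticks_gray
    tau_travel_transposition travel_seq_transitive.

Lemma traces_monodromy_of : traces lab monodromy_of.
Proof. by split=> // i k; apply: next_travel. Qed.

Lemma traces_sigma M : traces lab M -> forall i : 'I_r.+1, sigma M i = travel i.
Proof.
move=> [H _ _] i; apply/permP=> k; apply: next_travel_unique.
exact: H.
Qed.

End GraphToMonodromy.

(** The white faces partition the naturally oriented darts, so the parts of [mu] count the tick
    marks face by face. *)
Lemma card_tick (g d m n : nat) (mu : m.-tuple nat) (nu : n.-tuple nat)
    (G : hurwitz_graph g mu nu) : sumn mu = d -> #|{: tick G}| = d.
Proof.
move=> <-; rewrite card_sig -sum1_card.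
have := @sig_big_dep _ 0 addn G (fun x => 'I_(weight x)) (@natural G)
  (fun _ _ => true) (fun _ _ => 1).
rewrite (eq_bigl (fun t => natural (tag t))) => [<-|t]; last by rewrite andbT.
have [inj im] := white_faceP G.
have wF i : white_face G i \in white G by rewrite -im imset_f.
have fw := subsetP (white_faces G).
rewrite (eq_bigr (fun x : G => weight x)) => [|x _]; last first.
  by rewrite sum1_card card_ord.
rewrite (eq_bigl (fun x => x \in cover (white G))) => [|x]; last first.
  apply/idP/bigcupP=> [nx|[F WF]]; last exact: natural_mem_white.
  by exists (face_of x); rewrite // porbit_id.
rewrite big_trivIset; last first.
  apply/trivIsetP=> A B wA wB; apply: contraR => /pred0Pn[x /andP[/= xA xB]].
  by rewrite (face_eq (fw _ wA) xA) (face_eq (fw _ wB) xB).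
rewrite -im big_imset /=; last by move=> i j _ _; apply: inj.
rewrite (eq_bigr (fun i => tnth mu i)) => [|i _]; last exact: white_balanced.
rewrite sumnE big_tuple; apply: eq_bigl => i; rewrite inE //.
Qed.

(** * The flow along the strands of a monodromy sequence *)

Section Helix.

Variables (g d m n : nat) (mu : m.-tuple nat) (nu : n.-tuple nat).
Local Notation r := (num_branch g m n).
Hypothesis r_gt0 : 0 < r.
Variable M : monodromy_sequence g d mu nu.

Local Notation point := ('I_r * 'I_d)%type.

Lemma transpositionK (T : finType) (p : {perm T}) :
  is_transposition p -> involutive p.
Proof. by case=> x [y [_ ->]] z; rewrite -permM tperm2 perm1. Qed.

Lemma tauK i : involutive (tau (sigma M) i).
Proof. exact: transpositionK (tau_transposition M i). Qed.

(** Natural indices avoid casts in inductions on the rule; above [r] the value falls back to index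
    0. *)
Definition sigma_nat (s : nat) : {perm 'I_d} := sigma M (inord s).

Lemma sigma_natE (i : 'I_r.+1) : sigma_nat i = sigma M i.
Proof. by rewrite /sigma_nat inord_val. Qed.

Lemma sigma_natS (i : 'I_r) y :
  sigma_nat i.+1 y = tau (sigma M) i (sigma_nat i y).
Proof.
rewrite /tau comp_permE.
have -> : sigma_nat i.+1 = sigma M (lift ord0 i) by rewrite -sigma_natE.
have -> : sigma_nat i = sigma M (widen_ord (leqnSn r) i) by rewrite -sigma_natE.
by rewrite permK.
Qed.

Definition moved (z : point) : bool := tau (sigma M) z.1 z.2 != z.2.

Definition flip (s : nat) (i : 'I_r) (y : 'I_d) : 'I_d :=
  if i < s then tau (sigma M) i y else y.

Lemma flip_inj s i : injective (flip s i).
Proof. by rewrite /flip => x y; case: ifP => // _; apply: perm_inj. Qed.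

Lemma flip_moved s i y : moved (i, flip s i y) = moved (i, y).
Proof. by rewrite /moved /flip /=; case: ifP => // _; rewrite tauK eq_sym. Qed.

Lemma flip_fixed s z : ~~ moved z -> flip s z.1 z.2 = z.2.
Proof. by rewrite negbK /flip => /eqP ->; case: ifP. Qed.

(* Each [y] is a strand passing the levels [0, ..., r-1] in turn; past the last
   level it continues as [sigma_0 y].  The flow [helix s] moreover crosses the
   strands at the levels below [s].  The tick mark [y] is the point [(r-1, y)]. *)
Definition helix_fun (s : nat) (z : point) : point :=
  (ordS z.1, flip s (ordS z.1) (if z.1.+1 == r then sigma_nat 0 z.2 else z.2)).

Lemma helix_fun_inj s : injective (helix_fun s).
Proof.
move=> [i x] [j y] E; have /= /ordS_inj ij := congr1 fst E.
have := congr1 snd E; rewrite /= ij => /flip_inj.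
by case: ifP => _ => [/perm_inj|] ->.
Qed.

Definition helix s : {perm point} := perm (@helix_fun_inj s).

Lemma helixE s z : helix s z = helix_fun s z.
Proof. exact: permE. Qed.

Definition top : 'I_r := rev_ord (Ordinal r_gt0).

Lemma topE : top.+1 = r.
Proof. by rewrite /top /= subn1 prednK. Qed.

(** Crossing at the first [j] levels multiplies [sigma_0] by the first [j] transpositions, which
    telescopes to [sigma_j]. Hence a full lap of [helix s] is [sigma_s]. *)
Lemma helix_top s y (i : 'I_r) :
  iter i.+1 (helix s) (top, y) = (i, sigma_nat (minn s i.+1) y).
Proof.
case: i => i; elim: i => [|i IH] lti.
  rewrite /= helixE /helix_fun /= -/top topE eqxx.
  have -> : ordS top = Ordinal lti by apply: val_inj; rewrite /= -/top topE modnn.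
  rewrite /flip; congr (_, _); case: s => [|s] /=; first by rewrite min0n.
  by rewrite minnSS minn0 -(sigma_natS (Ordinal lti)).
rewrite iterS (IH (ltnW lti)) helixE /helix_fun /=.
have -> : ordS (Ordinal (ltnW lti)) = Ordinal lti.
  by apply: val_inj; rewrite /= modn_small.
rewrite (ltn_eqF lti) /flip /=; congr (_, _); case: ifP => lts.
  by rewrite (minn_idPr (ltnW lts)) (minn_idPr lts) -(sigma_natS (Ordinal lti)).
by congr (sigma_nat _ _); move: lts; lia.
Qed.

Lemma helix_lap s y : s <= r -> iter r (helix s) (top, y) = (top, sigma_nat s y).
Proof. by move=> les; have := helix_top s y top; rewrite topE (minn_idPl les). Qed.

(* The tick mark last met before [z] by the flow [helix s]. *)
Definition base s (z : point) : 'I_d := (sigma_nat (minn s z.1.+1))^-1%g z.2.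

Lemma baseK s (z : point) : iter z.1.+1 (helix s) (top, base s z) = z.
Proof. by rewrite helix_top permKV; case: z. Qed.

Lemma base_iter s y (i : 'I_r) : base s (iter i.+1 (helix s) (top, y)) = y.
Proof. by rewrite helix_top /base permK. Qed.

Lemma base_top s y : s <= r -> base s (top, sigma_nat s y) = y.
Proof. by move=> les; rewrite /base /= -/top topE (minn_idPl les) permK. Qed.

Lemma base_helix s z : s <= r ->
  base s (helix s z) = base s z \/ base s (helix s z) = sigma_nat s (base s z).
Proof.
move=> les; rewrite -{1 3}(baseK s z) -iterS.
have := ltn_ord z.1; rewrite leq_eqVlt => /orP[/eqP zr|lt]; last first.
  by left; rewrite (base_iter s _ (Ordinal lt)).
right; rewrite {1}zr iterS helix_lap //.
by rewrite -[helix s _]/(iter (Ordinal r_gt0).+1 (helix s) _) base_iter.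
Qed.

Lemma helix_porbit s z z' : s <= r ->
  (z' \in porbit (helix s) z) = (base s z' \in porbit (sigma_nat s) (base s z)).
Proof.
move=> les; apply/idP/idP.
  apply: (porbit_induction (B := fun z' => base s z' \in _)) => [|y IH].
    exact: porbit_id.
  case: (base_helix y les) => -> //.
  by apply: porbit_mem_trans IH _; apply: porbit_next.
have H u : u \in porbit (helix s) (top, base s u).
  by rewrite -{1}(baseK s u) -permX mem_porbit.
have H' : (top, base s z) \in porbit (helix s) z by rewrite porbit_sym.
move=> b; apply: (porbit_mem_trans H'); apply: porbit_mem_trans (H z').
move: b; apply: (porbit_induction (B := fun y => (top, y) \in _)) => [|y IH].
  exact: porbit_id.
by apply: porbit_mem_trans IH _; rewrite -helix_lap // -permX mem_porbit.
Qed.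

Lemma helixS s z : helix s z = ((helix 0 z).1, flip s (helix 0 z).1 (helix 0 z).2).
Proof. by rewrite !helixE. Qed.

Lemma moved_helix s z : moved (helix s z) = moved (helix 0 z).
Proof. by rewrite helixS flip_moved; case: (helix 0 z). Qed.

Lemma helix_fixed s z : ~~ moved (helix 0 z) -> helix s z = helix 0 z.
Proof. by move=> nm; rewrite helixS flip_fixed //; case: (helix 0 z). Qed.

(** Here the transitivity of the sequence enters: the strands of an orbit without moved points would
    be closed under [sigma_0] and fixed by every [tau], hence would be all strands, although [tau]
    at level 0 is a transposition. *)
Lemma meets_moved s z : s <= r -> meets (helix s) moved z.
Proof.
move=> les; case: (boolP [exists z' in porbit (helix s) z, moved z']).
  by case/existsP=> z' /andP[/porbitP[k ->] mk]; exists k; rewrite -permX.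
rewrite negb_exists => /forallP nm.
have {}nm z' : z' \in porbit (helix s) z -> ~~ moved z'.
  by move=> zz'; have := nm z'; rewrite zz'.
have orb0 z' : z' \in porbit (helix s) z -> helix 0 z' \in porbit (helix s) z.
  move=> zz'; have zs := porbit_mem_trans zz' (porbit_next _ _).
  by rewrite -(helix_fixed s) // -(moved_helix s) nm.
pose B y := (top, y) \in porbit (helix s) z.
have Bnm y i : B y -> (i, sigma_nat 0 y) \in porbit (helix s) z.
  move=> By; have := helix_top 0 y i; rewrite min0n => <-.
  exact: (iter_closed (B := fun z' => z' \in porbit (helix s) z)) By.
have B0 y : B (sigma_nat 0 y) = B y.
  by apply: perm_closed_sym => {}y By; apply: Bnm.
have Bt y i : B y -> tau (sigma M) i y = y.
  move=> By; have := @Bnm ((sigma_nat 0)^-1%g y) i; rewrite -B0 permKV => /(_ By) /nm.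
  by rewrite negbK => /eqP.
(* Continuing from [z] up to the top level yields a strand of the orbit. *)
have [y0 By0] : exists y, B y.
  exists (iter (r.-1 - z.1) (helix s) z).2.
  suff tE : (iter (r.-1 - z.1) (helix s) z).1 = top.
    rewrite /B -tE -surjective_pairing -permX mem_porbit //.
  rewrite -{2}(baseK s z) -iterD.
  have -> : (r.-1 - z.1 + z.1.+1 = top.+1)%N.
    by rewrite topE; have := ltn_ord z.1; lia.
  by rewrite helix_top.
have allB y : B y.
  apply: (transitive_closed (monodromy_transitive M)) By0 => p u.
  rewrite !inE => /orP[/eqP ->|/imsetP[i _ ->]] Bu; last by rewrite Bt.
  by rewrite -(sigma_natE ord0) B0.
have [u [v [ne E]]] := tau_transposition M (Ordinal r_gt0).
by move: ne; rewrite -{1}(Bt u (Ordinal r_gt0)) // E tpermL eqxx.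
Qed.

(** In the sum of the initial level and the number of steps, the remainder modulo [r] is the current
    level and the quotient counts the passages of the top level. *)
Lemma iter_helix0 k (z : point) :
  (iter k (helix 0) z).1 = (z.1 + k) %% r :> nat /\
  (iter k (helix 0) z).2 = iter ((z.1 + k) %/ r) (sigma_nat 0) z.2.
Proof.
elim: k => [|k [IH1 IH2]].
  by rewrite addn0 modn_small ?divn_small ?ltn_ord.
rewrite iterS helixE /helix_fun /= IH1 IH2 /flip /= addnS.
have [q [e [E lte]]] : exists q e, z.1 + k = q * r + e /\ e < r.
  by exists ((z.1 + k) %/ r), ((z.1 + k) %% r); rewrite -divn_eq ltn_mod.
rewrite E -addnS !modnMDl !divnMDl // (modn_small lte) (divn_small lte) addn0.
split=> //; case: eqP => [er|/eqP ne]; first by rewrite er divnn r_gt0 addn1.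
by rewrite divn_small ?addn0 // ltn_neqAle ne.
Qed.

(** One time serves all rules: the flows differ only in the crossings at moved points, so they agree
    until the return. The successor counts the step from [z] to [helix 0 z]. *)
Definition return_time (z : point) : nat := (hit (helix 0) moved (helix 0 z)).+1.

Definition return_point s (z : point) : point := first_return (helix s) moved z.

Lemma return_pointE z : return_point 0 z = iter (return_time z) (helix 0) z.
Proof. by rewrite /return_point /first_return /entry -iterSr. Qed.

Lemma return_time_min z j : 0 < j < return_time z -> ~~ moved (iter j (helix 0) z).
Proof.
case: j => // j lt; rewrite iterSr.
by have [_] := hitP (meets_moved (helix 0 z) (leq0n r)); apply.
Qed.

Lemma return_moved z : moved (return_point 0 z).
Proof. by have [] := hitP (meets_moved (helix 0 z) (leq0n r)). Qed.

Lemma return_time_unique z j : 0 < j -> moved (iter j (helix 0) z) ->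
  (forall i, 0 < i < j -> ~~ moved (iter i (helix 0) z)) -> return_time z = j.
Proof.
case: j => // j _ mj minj; congr _.+1; apply: hit_unique; first by rewrite -iterSr.
by move=> i lt; rewrite -iterSr minj.
Qed.

Lemma iter_helix_return s z j : j < return_time z ->
  iter j (helix s) z = iter j (helix 0) z.
Proof.
elim: j => // j IH lt; rewrite !iterS IH ?(ltnW lt) // helix_fixed //.
by rewrite -iterS return_time_min.
Qed.

Lemma iter_helix_returnE s z : iter (return_time z) (helix s) z =
  ((return_point 0 z).1, flip s (return_point 0 z).1 (return_point 0 z).2).
Proof.
rewrite return_pointE /return_time !iterS (iter_helix_return _ (ltnSn _)).
exact: helixS.
Qed.

Lemma return_pointS s z : return_point s z =
  ((return_point 0 z).1, flip s (return_point 0 z).1 (return_point 0 z).2).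
Proof.
rewrite -iter_helix_returnE /return_point /first_return /entry.
rewrite (@hit_unique _ _ _ _ (hit (helix 0) moved (helix 0 z))) -?iterSr //.
  rewrite -/(return_time z) iter_helix_returnE flip_moved.
  by have := return_moved z; case: (return_point 0 z).
by move=> j lt; rewrite -iterSr iter_helix_return // return_time_min.
Qed.

Lemma return_porbit s z z' : s <= r -> moved z -> moved z' ->
  base s z' \in porbit (sigma_nat s) (base s z) ->
  exists k, z' = iter k (return_point s) z.
Proof.
move=> les mz mz'; rewrite -helix_porbit //; exact: first_return_orbit.
Qed.

Lemma return_base_porbit s z : s <= r ->
  base s (return_point s z) \in porbit (sigma_nat s) (base s z).
Proof.
by move=> les; rewrite -helix_porbit //; apply: first_return_porbit.
Qed.

(* The number of points of the top level, that is, of tick marks, among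
   [z, helix 0 z, ...] before the return to a moved point. *)
Definition helix_weight (z : point) : nat := (z.1 + return_time z) %/ r.

Lemma helix_weightE (z : point) :
  z.1 + return_time z = helix_weight z * r + (return_point 0 z).1.
Proof.
rewrite return_pointE; have [-> _] := iter_helix0 (return_time z) z.
exact: divn_eq.
Qed.

End Helix.

(** * A Hurwitz ribbon graph is determined by its monodromy *)

Section Coordinates.

Variables (g d m n : nat) (mu : m.-tuple nat) (nu : n.-tuple nat).
Hypothesis d_gt0 : 0 < d.
Local Notation r := (num_branch g m n).
Hypothesis r_gt0 : 0 < r.
Variable M : monodromy_sequence g d mu nu.
Variables (G : hurwitz_graph g mu nu) (lab : 'I_d -> tick G).
Hypothesis lab_bij : bijective lab.
Hypothesis labM : traces lab M.
Local Notation edge_of := (edge_of lab).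
Local Notation rank_of := (rank_of lab).
Local Notation tick_at := (tick_at d_gt0 lab).
Local Notation first_label := (first_label d_gt0 lab).
Local Notation travel := (travel d_gt0 lab_bij).

Definition coord (x : G) : 'I_r * 'I_d := (vtx x, first_label 0 x).

Lemma sigma_nat_travel s : s <= r -> sigma_nat M s = travel s.
Proof.
by move=> les; rewrite /sigma_nat (traces_sigma d_gt0 lab_bij labM) inordK.
Qed.

Lemma tau_first_label (b : G) : natural b -> tau (sigma M) (vtx b) =
  tperm (first_label 0 b) (first_label 0 (rot G (rot G b))).
Proof.
move=> nb; rewrite -(tau_travel d_gt0 lab_bij nb) /tau /travel_seq.
by rewrite !(traces_sigma d_gt0 lab_bij labM).
Qed.

Lemma first_label_rot2_neq (b : G) : natural b ->
  first_label 0 b != first_label 0 (rot G (rot G b)).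
Proof.
move=> nb; rewrite first_label_neq ?natural_rot ?nb ?vtx_rot //.
by rewrite eq_sym rot2_neq.
Qed.

Lemma coord_moved x : natural x -> moved M (coord x).
Proof.
move=> nx; rewrite /moved /= tau_first_label // tpermL eq_sym.
exact: first_label_rot2_neq.
Qed.

Lemma moved_coord z : moved M z -> exists2 x, natural x & coord x = z.
Proof.
case: z => i y; have [b nb <-] := exists_natural G i.
rewrite /moved /= tau_first_label //.
case: tpermP => [-> _|-> _|_ _]; last by rewrite eqxx.
  by exists b.
exists (rot G (rot G b)); first by rewrite !natural_rot nb.
by rewrite /coord !vtx_rot.
Qed.

Lemma coord_inj x y : natural x -> natural y -> coord x = coord y -> x = y.
Proof.
move=> nx ny [vE fE]; apply/eqP; apply: contraT => ne.
by have := first_label_neq d_gt0 lab_bij 0 nx ny vE ne; rewrite fE eqxx.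
Qed.

(** The left turn and the weight can be read off the sequence alone, which forces uniqueness: the
    flow from the coordinates of [x] first returns at those of the next edge, after a time that
    encodes the weight. *)
Lemma return_coord x : natural x ->
  vtx x + return_time M (coord x) = weight x * r + vtx (turn_left G x) /\
  return_point M 0 (coord x) = coord (turn_left G x).
Proof.
have tE : turn_left G x = turn 0 x by rewrite turnE.
rewrite tE => nx; have nt : natural (turn 0 x) by rewrite natural_turn.
have lt_t := ltn_ord (vtx (turn 0 x)); have lt_x := ltn_ord (vtx x).
(* Positivity of the weighting, as positivity of the return time. *)
have gt0 : vtx x < weight x * r + vtx (turn 0 x).
  case wx: (weight x) => [|w]; first exact: weight0_vtx.
  by rewrite mulSn -addnA; apply: leq_trans lt_x (leq_addr _ _).
have iter_label : iter (weight x) (sigma_nat M 0) (first_label 0 x) =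
    first_label 0 (turn 0 x).
  by rewrite sigma_nat_travel // iter_travel_weight.
have iterE : iter (weight x * r + vtx (turn 0 x) - vtx x) (helix M 0) (coord x) =
    coord (turn 0 x).
  have [E1 E2] := iter_helix0 r_gt0 M
     (weight x * r + vtx (turn 0 x) - vtx x) (coord x).
  move: E1 E2; rewrite /= subnKC ?(ltnW gt0) //.
  rewrite modnMDl divnMDl // modn_small // divn_small // addn0 iter_label.
  case: (iter _ _ _) => i y /= iE ->; congr (_, _); exact: val_inj.
suff tmE : return_time M (coord x) = weight x * r + vtx (turn 0 x) - vtx x.
  by rewrite return_pointE tmE iterE subnKC // ltnW.
apply: return_time_unique => //; first by rewrite subn_gt0.
  by rewrite iterE coord_moved.
(* An earlier moved point would be the coordinates of an edge [z] whose first tick mark lies [k]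
   jumps after the first one of [x]. *)
move=> j /andP[j0 ltj]; apply/negP=> /moved_coord[z nz].
have [] := iter_helix0 r_gt0 M j (coord x); rewrite /=.
set p := iter j _ _ => E1 E2 zE.
have {E1} vz : vtx z = (vtx x + j) %% r :> nat by rewrite -E1 -zE.
have {E2} fz : first_label 0 z = iter ((vtx x + j) %/ r) (travel 0) (first_label 0 x).
  by rewrite -sigma_nat_travel // -E2 -zE.
have := divn_eq (vtx x + j) r; move: vz fz.
set k := (vtx x + j) %/ r => vz fz; rewrite -vz => jE.
have lez : vtx z <= vtx (first_edge 0 z) by apply: first_edge_vtx.
(* Below the weight, rank 0 forces [k = 0], and [z] would start above the edge [x] it leads up to.
   Above the weight, [j] is too large. At equality, confluence makes [x] empty and [z] no higher
   than [x], whereas [j > 0] puts it higher. *)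
case: (ltngtP k (weight x)) => ltk.
- move: fz; rewrite iter_travel // => fz.
  have [ez rz] := first_labelP d_gt0 lab_bij 0 nz.
  move: rz ez; rewrite fz.
  have [-> ->] := tick_atP d_gt0 lab_bij nx ltk.
  by move=> k0 xE; move: lez; rewrite -xE; move: jE; rewrite k0; lia.
- have := leq_mul ltk (leqnn r); move: jE ltj; rewrite mulSn; lia.
move: fz; rewrite ltk iter_travel_weight // => /(first_label_eq lab_bij nz nt) E.
have ltz : vtx z < vtx (turn 0 x) by move: jE ltj; rewrite ltk; lia.
case: (first_edge_confluent nz nt E (ltnW ltz)) => [zt|[c [nc wc lec]]].
  by rewrite zt ltnn in ltz.
move=> /turn_inj xc; move: lec jE; rewrite -xc ltk xc wc -xc; lia.
Qed.

Lemma mem_white_label x i : natural x -> 0 < weight x ->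
  (x \in white_face G i) = (first_label 0 x \in first_cycle M i).
Proof.
move=> nx wx; have [_ -> _] := labM.
rewrite mem_ticks_white; last first.
  by have [_ <-] := white_faceP G; apply: imset_f.
have [-> _] := first_labelP d_gt0 lab_bij 0 nx.
by rewrite first_edge_id.
Qed.

Lemma mem_gray_label x j : natural x -> 0 < weight x ->
  (opp G x \in gray_face G j) = (first_label 0 x \in last_cycle M j).
Proof.
move=> nx wx; have [_ _ ->] := labM.
rewrite mem_ticks_gray; last first.
  by have [_ <-] := gray_faceP G; apply: imset_f.
have [-> _] := first_labelP d_gt0 lab_bij 0 nx.
by rewrite first_edge_id.
Qed.

Lemma first_cycle_heavy i :
  exists x, [/\ natural x, 0 < weight x & x \in white_face G i].
Proof.
have wF : white_face G i \in white G.
  by have [_ <-] := white_faceP G; apply: imset_f.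
have [k] := ticks_white_nonempty d_gt0 lab_bij wF; rewrite mem_ticks_white // => kF.
by exists (edge_of k); rewrite natural_edge edge_weight.
Qed.

Lemma last_cycle_heavy j :
  exists x, [/\ natural x, 0 < weight x & opp G x \in gray_face G j].
Proof.
have wF : gray_face G j \in gray G.
  by have [_ <-] := gray_faceP G; apply: imset_f.
have [k] := ticks_gray_nonempty d_gt0 lab_bij wF; rewrite mem_ticks_gray // => kF.
by exists (edge_of k); rewrite natural_edge edge_weight.
Qed.

End Coordinates.

(** * Comparison of two graphs with the same monodromy *)

Section Uniqueness.

Variables (g d m n : nat) (mu : m.-tuple nat) (nu : n.-tuple nat).
Hypothesis d_gt0 : 0 < d.
Local Notation r := (num_branch g m n).
Hypothesis r_gt0 : 0 < r.
Variable M : monodromy_sequence g d mu nu.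

Section Comparison.

Variables (G G' : hurwitz_graph g mu nu).
Variables (lab : 'I_d -> tick G) (lab' : 'I_d -> tick G').
Hypothesis lab_bij : bijective lab.
Hypothesis lab'_bij : bijective lab'.
Hypothesis labM : traces lab M.
Hypothesis labM' : traces lab' M.
Local Notation coord' := (coord d_gt0 lab').
Local Notation coord := (coord d_gt0 lab).

(** The second alternative makes the choice total: an incoming end receives some natural dart. *)
Lemma same_coord_exists (x : G) : exists y : G',
  natural y && ((coord' y == coord x) || ~~ natural x).
Proof.
case nx: (natural x); last first.
  by have [y ny _] := exists_natural G' (vtx x); exists y; rewrite ny orbT.
have [y ny E] := moved_coord d_gt0 lab'_bij labM' (coord_moved d_gt0 lab_bij labM nx).
by exists y; rewrite ny E eqxx.
Qed.

Definition same_coord (x : G) : G' := xchoose (same_coord_exists x).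

Lemma natural_same_coord x : natural (same_coord x).
Proof. by have /andP[] := xchooseP (same_coord_exists x). Qed.

Lemma coord_same_coord x : natural x -> coord' (same_coord x) = coord x.
Proof.
by move=> nx; have /andP[_ /orP[/eqP|/negP[]]] := xchooseP (same_coord_exists x).
Qed.

Lemma same_coord_left x : natural x ->
  weight (same_coord x) = weight x /\
  same_coord (turn_left G x) = turn_left G' (same_coord x).
Proof.
move=> nx; have ny := natural_same_coord x; have E := coord_same_coord nx.
have nl : natural (turn_left G x) by rewrite natural_left.
have [N1 P1] := return_coord d_gt0 r_gt0 lab_bij labM nx.
have [N2 P2] := return_coord d_gt0 r_gt0 lab'_bij labM' ny.
have cE : coord' (turn_left G' (same_coord x)) = coord (turn_left G x).
  by rewrite -P1 -P2 E.
split; last first.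
  apply: (coord_inj lab'_bij) => //; rewrite ?natural_same_coord //.
    by rewrite natural_left.
  by rewrite cE coord_same_coord.
have [vE _] := E; have [vE' _] := cE.
apply/eqP; rewrite -(eqn_pmul2r r_gt0) -(eqn_add2r (vtx (turn_left G x))).
by rewrite -N1 -{1}vE' -N2 E vE.
Qed.

Lemma same_coord_rot2 x : natural x ->
  same_coord (rot G (rot G x)) = rot G' (rot G' (same_coord x)).
Proof.
move=> nx; have nx2 : natural (rot G (rot G x)) by rewrite !natural_rot nx.
have ny := natural_same_coord x; have ny2 := natural_same_coord (rot G (rot G x)).
have [vE1 _] := coord_same_coord nx; have [vE2 _] := coord_same_coord nx2.
case: (natural_vertex ny ny2) => //; first by rewrite vE1 vE2 !vtx_rot.
move=> E; have := coord_same_coord nx2; rewrite E coord_same_coord //.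
by move/(coord_inj lab_bij nx nx2) => xE; have := rot2_neq x; rewrite -xE eqxx.
Qed.

Definition comparison (x : G) : G' :=
  if natural x then same_coord x else opp G' (same_coord (opp G x)).

Lemma natural_comparison x : natural (comparison x) = natural x.
Proof.
by rewrite /comparison; case: ifP; rewrite ?natural_opp natural_same_coord.
Qed.

Lemma comparison_opp x : comparison (opp G x) = opp G' (comparison x).
Proof.
by rewrite /comparison natural_opp; case: (natural x); rewrite /= !oppK.
Qed.

(** From a natural dart [rot] undoes a left turn; from an incoming end it is a left turn followed by
    the square of [rot]. Both operations are already respected on natural darts. *)
Lemma comparison_rot x : comparison (rot G x) = rot G' (comparison x).
Proof.
case nx: (natural x); rewrite /comparison natural_rot nx /=.
  set y := opp G (rot G x).
  have ny : natural y by rewrite natural_opp natural_rot nx.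
  have xE : turn_left G y = x by rewrite turn_leftE oppK permK.
  have [_] := same_coord_left ny; rewrite xE => ->.
  by rewrite turn_leftE permKV.
set u := (rot G)^-1%g x; have xE : x = rot G u by rewrite permKV.
have nu_ : natural u by rewrite -[natural u]negbK -natural_rot -xE nx.
rewrite {1}xE same_coord_rot2 //.
set y := opp G x.
have ny : natural y by rewrite natural_opp nx.
have uE : turn_left G y = u by rewrite turn_leftE oppK.
have [_] := same_coord_left ny; rewrite uE => ->.
by rewrite turn_leftE permKV.
Qed.

Lemma weight_comparison x : weight (comparison x) = weight x.
Proof.
rewrite /comparison; case nx: (natural x).
  by have [->] := same_coord_left nx.
have ny : natural (opp G x) by rewrite natural_opp nx.
by rewrite weight_opp; have [-> _] := same_coord_left ny; rewrite weight_opp.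
Qed.

Lemma vtx_comparison x : vtx (comparison x) = vtx x.
Proof.
wlog nx : x / natural x.
  move=> H; case nx: (natural x); first exact: H.
  by rewrite -(vtx_rot x) -H ?natural_rot ?nx // comparison_rot vtx_rot.
by rewrite /comparison nx; have [] := coord_same_coord nx.
Qed.

Lemma comparison_face x : comparison @: face_of x = face_of (comparison x).
Proof.
have leftE y : comparison (turn_left G y) = turn_left G' (comparison y).
  apply: (@perm_inj _ (rot G')).
  by rewrite -comparison_rot !turn_leftE !permKV comparison_opp.
have iterE k y : comparison ((turn_left G ^+ k)%g y) =
    (turn_left G' ^+ k)%g (comparison y).
  by rewrite !permX; elim: k => //= k <-.
apply/setP=> z; apply/imsetP/porbitP=> [[y /porbitP[k ->] ->]|[k ->]].
  by exists k.
by exists ((turn_left G ^+ k)%g x); rewrite ?mem_porbit.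
Qed.

Lemma comparison_first_label x : natural x ->
  first_label d_gt0 lab' 0 (comparison x) = first_label d_gt0 lab 0 x.
Proof. by move=> nx; rewrite /comparison nx; have [] := coord_same_coord nx. Qed.

Lemma comparison_faces F : F \in faces G -> comparison @: F \in faces G'.
Proof. by case/imsetP=> x _ ->; rewrite [_ @: _]comparison_face imset_f. Qed.

Lemma face_meet (H : bicolored_graph) (A B : {set H}) x :
  A \in faces H -> B \in faces H -> x \in A -> x \in B -> A = B.
Proof. by move=> fA fB xA xB; rewrite (face_eq fA xA) (face_eq fB xB). Qed.

(** Faces are disjoint, so one common dart suffices. It is chosen with tick marks, because then the
    cycles of [M] show its face. *)
Lemma comparison_white i : comparison @: white_face G i = white_face G' i.
Proof.
have wG (H : hurwitz_graph g mu nu) : white_face H i \in faces H.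
  apply: (subsetP (white_faces H)).
  by have [_ <-] := white_faceP H; apply: imset_f.
have [x [nx wx xF]] := first_cycle_heavy d_gt0 lab_bij i.
apply: (face_meet (x := comparison x)).
- exact/comparison_faces/wG.
- exact: wG.
- exact: imset_f.
move: xF; rewrite (mem_white_label d_gt0 lab_bij labM) //.
rewrite (mem_white_label d_gt0 lab'_bij labM') ?natural_comparison //.
  by rewrite comparison_first_label.
by rewrite weight_comparison.
Qed.

Lemma comparison_gray j : comparison @: gray_face G j = gray_face G' j.
Proof.
have wG (H : hurwitz_graph g mu nu) : gray_face H j \in faces H.
  suff: gray_face H j \in gray H by rewrite inE => /andP[].
  by have [_ <-] := gray_faceP H; apply: imset_f.
have [x [nx wx xF]] := last_cycle_heavy d_gt0 lab_bij j.
apply: (face_meet (x := comparison (opp G x))).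
- exact/comparison_faces/wG.
- exact: wG.
- exact: imset_f.
move: xF; rewrite (mem_gray_label d_gt0 lab_bij labM) // comparison_opp.
rewrite (mem_gray_label d_gt0 lab'_bij labM') ?natural_comparison //.
  by rewrite comparison_first_label.
by rewrite weight_comparison.
Qed.

End Comparison.

Lemma comparisonK (G G' : hurwitz_graph g mu nu)
    (lab : 'I_d -> tick G) (lab' : 'I_d -> tick G')
    (lab_bij : bijective lab) (lab'_bij : bijective lab')
    (labM : traces lab M) (labM' : traces lab' M) :
  cancel (comparison lab_bij lab'_bij labM labM')
         (comparison lab'_bij lab_bij labM' labM).
Proof.
move=> x; wlog nx : x / natural x.
  move=> H; case nx: (natural x); first exact: H.
  have := H (opp G x); rewrite natural_opp nx !comparison_opp => /(_ isT).
  exact: perm_inj.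
rewrite {1}/comparison natural_comparison nx /comparison nx.
apply: (coord_inj lab_bij) => //; rewrite ?natural_same_coord //.
by rewrite coord_same_coord ?natural_same_coord // coord_same_coord.
Qed.

Lemma traces_iso (G G' : hurwitz_graph g mu nu)
    (lab : 'I_d -> tick G) (lab' : 'I_d -> tick G') :
  bijective lab -> bijective lab' -> traces lab M -> traces lab' M ->
  hurwitz_iso G G'.
Proof.
move=> lab_bij lab'_bij labM labM'.
pose f := comparison lab_bij lab'_bij labM labM'.
have fK : cancel f (comparison lab'_bij lab_bij labM' labM) by apply: comparisonK.
have Kf : cancel (comparison lab'_bij lab_bij labM' labM) f by apply: comparisonK.
exists f; split.
- by exists (comparison lab'_bij lab_bij labM' labM).
- by split=> x; [apply: comparison_opp|apply: comparison_rot].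
- move=> F /imsetP[x _ ->].
  by rewrite [f @: _](comparison_face _ _ _ _ x); apply: natural_comparison.
- split; [move=> i | exact: comparison_white | exact: comparison_gray].
  apply/setP=> y; rewrite -(Kf y) mem_imset; last exact: (can_inj fK).
  by rewrite !mem_vertex [vtx (f _)]vtx_comparison.
exact: weight_comparison.
Qed.

End Uniqueness.

(** * From monodromy sequences to Hurwitz ribbon graphs *)

Lemma labeling_porbit (T : finType) (p : {perm T}) k (l : 'I_k -> {set T}) i x :
  is_labeling (porbits p) l -> x \in l i -> l i = porbit p x.
Proof.
case=> _ im; have: l i \in porbits p by rewrite -im imset_f.
by case/imsetP=> y _ -> /porbit_eq ->.
Qed.

Lemma labeling_closed (T : finType) (p : {perm T}) k (l : 'I_k -> {set T}) i x y :
  is_labeling (porbits p) l -> y \in porbit p x -> (y \in l i) = (x \in l i).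
Proof.
move=> lab yx; apply/idP/idP=> H; rewrite (labeling_porbit lab H) //.
by rewrite porbit_sym.
Qed.

Lemma labeling_nonempty (T : finType) (p : {perm T}) k (l : 'I_k -> {set T}) i :
  is_labeling (porbits p) l -> exists x, x \in l i.
Proof.
case=> _ im; have: l i \in porbits p by rewrite -im imset_f.
by case/imsetP=> y _ ->; exists y; apply: porbit_id.
Qed.

Lemma labeling_exists (T : finType) (p : {perm T}) k (l : 'I_k -> {set T}) x :
  is_labeling (porbits p) l -> exists i, x \in l i.
Proof.
case=> _ im; have: porbit p x \in porbits p by apply: imset_f.
by rewrite -im => /imsetP[i _ E]; exists i; rewrite -E porbit_id.
Qed.

Section Reconstruction.

Variables (g d m n : nat) (mu : m.-tuple nat) (nu : n.-tuple nat).
Local Notation r := (num_branch g m n).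
Hypothesis r_gt0 : 0 < r.
Variable M : monodromy_sequence g d mu nu.
Local Notation tau := (tau (sigma M)).
Local Notation top := (top r_gt0).

(* The naturally oriented edge that leaves the vertex [i] towards the tick mark
   [y] when one turns left at all later vertices. *)
Definition edge : finType := {z : 'I_r * 'I_d | moved M z}.

Definition level (e : edge) : 'I_r := (val e).1.
Definition strand (e : edge) : 'I_d := (val e).2.

Lemma edge_eq (e f : edge) : level e = level f -> strand e = strand f -> e = f.
Proof.
rewrite /level /strand => E1 E2; apply: val_inj.
by rewrite (surjective_pairing (val e)) E1 E2 -surjective_pairing.
Qed.

Definition left_fun (e : edge) : edge :=
  exist _ (return_point M 0 (val e)) (return_moved r_gt0 M (val e)).

Lemma left_fun_inj : injective left_fun.
Proof.
move=> e f /(congr1 val) /= E; apply: val_inj.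
by apply: (first_return_inj _ _ E); apply: (valP _).
Qed.

Definition left : {perm edge} := perm left_fun_inj.

Lemma val_left e : val (left e) = return_point M 0 (val e).
Proof. by rewrite permE. Qed.

Lemma swap_moved (e : edge) : moved M (level e, tau (level e) (strand e)).
Proof.
rewrite /moved /= tauK eq_sym; exact: (valP e).
Qed.

Definition swap_fun (e : edge) : edge := 
  exist (fun z => moved M z) _ (swap_moved e).

Lemma swap_funK : involutive swap_fun.
Proof. by move=> e; apply: edge_eq; rewrite //= /strand /= tauK. Qed.

Definition swap : {perm edge} := perm (inv_inj swap_funK).

Lemma swapE e : swap e = swap_fun e. Proof. exact: permE. Qed.

Lemma swapK : involutive swap.
Proof. by move=> e; rewrite !swapE swap_funK. Qed.

Lemma level_swap e : level (swap e) = level e. Proof. by rewrite swapE. Qed.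

Lemma strand_swap e : strand (swap e) = tau (level e) (strand e).
Proof. by rewrite swapE. Qed.

Lemma swap_neq e : swap e != e.
Proof.
apply/eqP=> E; have := valP e; rewrite /moved /=.
by rewrite -[tau _ _]strand_swap E eqxx.
Qed.

(** A transposition moves exactly two strands, which will give each vertex two outgoing edges. *)
Lemma same_level e f : level f = level e -> f = e \/ f = swap e.
Proof.
move=> E; have [u [v [ne tE]]] := tau_transposition M (level e).
have mv h : level h = level e -> strand h = u \/ strand h = v.
  move=> hE; have := valP h; rewrite /moved /= -/(level h) hE tE -/(strand h).
  by case: tpermP => [->|->|]; rewrite ?eqxx; [left|right|].
have se := strand_swap e; rewrite tE in se.
case: (mv f E) => fE; case: (mv e erefl) => eE.
- by left; apply: edge_eq; rewrite ?fE ?eE.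
- by right; apply: edge_eq; rewrite ?level_swap // se eE tpermR.
- by right; apply: edge_eq; rewrite ?level_swap // se eE tpermL.
- by left; apply: edge_eq; rewrite ?fE ?eE.
Qed.

Lemma exists_level i : exists e, level e = i.
Proof.
have [u [v [ne tE]]] := tau_transposition M i.
have mu_ : moved M (i, u) by rewrite /moved /= tE tpermL eq_sym.
by exists (exist (fun z => moved M z) _ mu_).
Qed.

Lemma return_perm_porbit s (p : {perm edge}) : s <= r ->
  (forall e, val (p e) = return_point M s (val e)) ->
  forall e f, (f \in porbit p e) =
    (base M s (val f) \in porbit (sigma_nat M s) (base M s (val e))).
Proof.
move=> les pE e f; apply/idP/idP.
  apply: (porbit_induction (B := fun f => base M s (val f) \in _)) => [|h IH].
    exact: porbit_id.
  apply: porbit_mem_trans IH _; rewrite pE; exact: return_base_porbit.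
move=> /(return_porbit r_gt0 les (valP e) (valP f))[k E].
have -> : f = (p ^+ k)%g e; last exact: mem_porbit.
apply: val_inj; rewrite /= E permX.
by elim: k {E} => //= k ->; rewrite pE.
Qed.

Lemma base0 z : base M 0 z = (sigma_nat M 0)^-1%g z.2.
Proof. by rewrite /base min0n. Qed.

Lemma porbit_shift (T : finType) (p : {perm T}) x y :
  (p^-1%g y \in porbit p (p^-1%g x)) = (y \in porbit p x).
Proof.
apply: mem_porbit_morph => [|z]; first exact: perm_inj.
by rewrite permK permKV.
Qed.

Lemma left_porbit e f :
  (f \in porbit left e) = (strand f \in porbit (sigma_nat M 0) (strand e)).
Proof.
rewrite (return_perm_porbit (leq0n r) val_left) !base0; exact: porbit_shift.
Qed.

Definition right : {perm edge} := (left * swap)%g.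

(** [helix r] crosses at every level, so it returns on the other outgoing edge of the vertex where
    [helix 0] returns. *)
Lemma val_right e : val (right e) = return_point M r (val e).
Proof.
rewrite permM swapE return_pointS // /= /level /strand val_left.
by rewrite /flip ltn_ord.
Qed.

Lemma right_porbit e f : (f \in porbit right e) =
  (base M r (val f) \in porbit (sigma_nat M r) (base M r (val e))).
Proof. exact: return_perm_porbit (leqnn r) val_right e f. Qed.

Lemma exists_edge_orbit s y : s <= r ->
  exists e : edge, base M s (val e) \in porbit (sigma_nat M s) y.
Proof.
move=> les; have [k mk] := meets_moved r_gt0 M (top, sigma_nat M s y) les.
exists (exist (fun z => moved M z) _ mk); rewrite /= -{2}(base_top r_gt0 M y les).
by rewrite -(helix_porbit r_gt0) // -permX mem_porbit.
Qed.

(* The dart [(e, true)] is [e] leaving its tail; [(e, false)] is the incoming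
   edge-end following it counterclockwise, which belongs to [left^-1 e]. *)
Definition opp_fun (x : edge * bool) : edge * bool :=
  if x.2 then (left x.1, false) else (left^-1%g x.1, true).

Definition rot_fun (x : edge * bool) : edge * bool :=
  if x.2 then (x.1, false) else (swap x.1, true).

Lemma opp_funK : involutive opp_fun.
Proof. by case=> e []; rewrite /opp_fun /= ?permK ?permKV. Qed.

Lemma rot_fun_inj : injective rot_fun.
Proof.
move=> [e b] [f c] E; move: (congr1 fst E) (congr1 snd E).
by rewrite /rot_fun; case: b c {E} => [] [] //= => [->|/perm_inj ->].
Qed.

Definition dart_opp : {perm edge * bool} := perm (inv_inj opp_funK).
Definition dart_rot : {perm edge * bool} := perm rot_fun_inj.

Lemma dart_oppE x : dart_opp x = opp_fun x. Proof. exact: permE. Qed.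
Lemma dart_rotE x : dart_rot x = rot_fun x. Proof. exact: permE. Qed.

Lemma dart_oppK : involutive dart_opp.
Proof. by move=> x; rewrite !dart_oppE opp_funK. Qed.

Lemma dart_opp_neq x : dart_opp x != x.
Proof. by rewrite dart_oppE; case: x => e []; rewrite xpair_eqE /= andbF. Qed.

Lemma darts_transitive :
  [transitive <<[set dart_opp; dart_rot]>>, on [set: edge * bool] | 'P].
Proof.
have [e0 _] := exists_level (Ordinal r_gt0).
apply: (@closed_transitive _ _ (e0, true)) => B clB x y Bx.
have Bo z : B (dart_opp z) = B z.
  by apply: perm_closed_sym => u; apply: clB; rewrite !inE eqxx.
have Br z : B (dart_rot z) = B z.
  by apply: perm_closed_sym => u; apply: clB; rewrite !inE eqxx orbT.
pose C e := B (e, true).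
have BC e b : B (e, b) = C e.
  by case: b => //; rewrite /C -(Br (e, true)) dart_rotE.
have Cl e : C (left e) = C e.
  by rewrite -(BC _ false) -(Bo (_, false)) dart_oppE /opp_fun /= permK.
have Cs e : C (swap e) = C e by rewrite -[RHS](BC _ false) -(Br (e, false)) dart_rotE.
(* To use transitivity on strands, [C] is spread over whole cycles of [sigma_0], which correspond to
   the orbits of [left]. *)
pose S u := [exists e, C e && (strand e \in porbit (sigma_nat M 0) u)].
have CS e : C e = S (strand e).
  apply/idP/existsP=> [Ce|[f /andP[Cf]]]; first by exists e; rewrite Ce porbit_id.
  rewrite -left_porbit porbit_sym => H.
  by apply: (porbit_induction (B := C) Cf _ H) => h; rewrite Cl.
suff allS u : S u by rewrite [y]surjective_pairing BC CS.
apply: (transitive_closed (monodromy_transitive M)) (_ : S (strand x.1)).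
  move=> p v; rewrite !inE => /orP[/eqP ->|/imsetP[i _ ->]].
    rewrite -(sigma_natE M ord0) => /existsP[e /andP[Ce eE]]; apply/existsP.
    by exists e; rewrite Ce porbit_sym; apply: porbit_mem_trans (porbit_next _ _);
       rewrite porbit_sym.
  (* A strand moved by [tau i] belongs to an edge at level [i], and [swap] realizes the move. *)
  case: (eqVneq (tau i v) v) => [-> //|mv].
  have -> : v = strand (exist (fun z => moved M z) (i, v) mv : edge) by [].
  by rewrite -CS -Cs CS strand_swap.
by rewrite -CS -(BC _ x.2) -surjective_pairing.
Qed.

Definition ribbon_of : ribbon_graph :=
  RibbonGraph dart_oppK dart_opp_neq darts_transitive.

Lemma left_true e : turn_left ribbon_of (e, true) = (left e, true).
Proof.
rewrite permM; apply: (@perm_inj _ dart_rot); rewrite permKV dart_rotE.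
by rewrite /= dart_oppE.
Qed.

Lemma left_false e : turn_left ribbon_of (e, false) = (swap (left^-1%g e), false).
Proof.
rewrite permM; apply: (@perm_inj _ dart_rot); rewrite permKV dart_rotE.
by rewrite /= dart_oppE /rot_fun /= swapK.
Qed.

Lemma left_color (x : ribbon_of) : (turn_left ribbon_of x).2 = x.2.
Proof. by case: x => e []; rewrite ?left_true ?left_false. Qed.

Lemma porbit_color (x y : ribbon_of) : y \in porbit (turn_left ribbon_of) x -> y.2 = x.2.
Proof.
apply: (porbit_induction (B := fun y : ribbon_of => y.2 = x.2)) => // z <-.
exact: left_color.
Qed.

Lemma face_true e (x : ribbon_of) : (x \in face_of ((e, true) : ribbon_of)) =
  x.2 && (strand x.1 \in porbit (sigma_nat M 0) (strand e)).
Proof.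
rewrite -left_porbit /face_of; case: x => f [] /=.
  apply: (@mem_porbit_morph _ _ (fun e : edge => (e, true) : ribbon_of)).
    by move=> ? ? [].
  by move=> h; rewrite left_true.
by apply/negP=> /porbit_color.
Qed.

(** The dart [(e, false)] reverses [left^-1 e]; the gray boundary arriving along that edge turns
    right, onto [swap e]. *)
Definition gray_base (e : edge) : 'I_d := base M r (val (swap e)).

Lemma face_false e (x : ribbon_of) : (x \in face_of ((e, false) : ribbon_of)) =
  ~~ x.2 && (gray_base x.1 \in porbit (sigma_nat M r) (gray_base e)).
Proof.
rewrite /gray_base -right_porbit /face_of; case: x => f [] /=.
  by apply/negP=> /porbit_color.
(* On these darts [turn_left] is [left^-1] followed by [swap]; inverted and conjugated by [swap], it
   becomes [right]. *)
rewrite (mem_porbit_morph (f := swap) (p := (left^-1 * swap)^-1%g)); last 2 first.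
- exact: perm_inj.
- by move=> h; rewrite invMg invgK !permM; congr (swap (left _));
     apply: (@perm_inj _ swap); rewrite permKV swapK.
rewrite porbitV.
apply: (@mem_porbit_morph _ _ (fun e : edge => (e, false) : ribbon_of)).
  by move=> ? ? [].
by move=> h; rewrite left_false permM.
Qed.

(** * Colors, vertices and faces of the reconstructed graph *)

Definition white_of : {set {set ribbon_of}} :=
  [set face_of ((e, true) : ribbon_of) | e : edge].

Lemma white_of_color (x : ribbon_of) : (face_of x \in white_of) = x.2.
Proof.
apply/imsetP/idP=> [[e _ E]|].
  have := porbit_id (turn_left ribbon_of) x.
  by rewrite -/(face_of x) E face_true => /andP[].
by case: x => e [] // _; exists e.
Qed.

Lemma white_of_faces : white_of \subset faces ribbon_of.
Proof. by apply/subsetP=> F /imsetP[e _ ->]; apply: imset_f. Qed.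

Lemma white_of_separates (x : ribbon_of) :
  (face_of (opp ribbon_of x) \in white_of) = (face_of x \notin white_of).
Proof. by rewrite !white_of_color /= dart_oppE; case: x => e []. Qed.

Definition bicolored_of : bicolored_graph :=
  BicoloredGraph white_of_faces white_of_separates.

Lemma natural_of (x : bicolored_of) : natural x = x.2.
Proof. exact: white_of_color. Qed.

Definition vertex_of (i : 'I_r) : {set bicolored_of} := [set x | level x.1 == i].

Lemma rot_porbit (x : bicolored_of) : porbit dart_rot x = vertex_of (level x.1).
Proof.
apply/setP=> y; rewrite inE; apply/idP/eqP.
  apply: (porbit_induction (B := fun y : edge * bool => level y.1 = _)) => // z <-.
  by rewrite dart_rotE /rot_fun; case: z.2 => //=; rewrite level_swap.
move=> /same_level; case: x y => e b [f c] /= ef.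
suff: exists k, (f, c) = iter k dart_rot (e, b).
  by case=> k ->; rewrite -permX mem_porbit.
have R1 h : dart_rot (h, true) = (h, false) by rewrite dart_rotE.
have R2 h : dart_rot (h, false) = (swap h, true) by rewrite dart_rotE.
(* The exponents are distances in the counterclockwise order [(e, true)], [(e, false)],
   [(swap e, true)], [(swap e, false)]. *)
by case: b; case: c; case: ef => ->;
  [exists 0|exists 2|exists 1|exists 3|exists 3|exists 1|exists 0|exists 2];
  rewrite /= ?(R1, R2, swapK).
Qed.

Lemma card_vertex_of i : #|vertex_of i| = 4.
Proof.
have [e <-] := exists_level i.
have -> : vertex_of (level e) = setX [set e; swap e] [set: bool].
  apply/setP=> [[f b]]; rewrite !inE /= andbT; apply/eqP/orP.
    by case/same_level=> ->; rewrite eqxx; [left|right].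
  by case=> /eqP ->; rewrite ?level_swap.
by rewrite cardsX cards2 cardsT card_bool eq_sym swap_neq.
Qed.

Lemma vertices_of V : V \in vertices bicolored_of -> #|V| = 4.
Proof. by case/imsetP=> x _ ->; rewrite rot_porbit card_vertex_of. Qed.

Lemma vertex_of_labeling : is_labeling (vertices bicolored_of) vertex_of.
Proof.
split=> [i j E|].
  have [e eE] := exists_level i; have: ((e, true) : bicolored_of) \in vertex_of j.
    by rewrite -E inE eE.
  by rewrite inE eE => /eqP.
apply/setP=> V; apply/imsetP/imsetP=> [[i _ ->]|[x _ ->]].
  by have [e <-] := exists_level i; exists (e, true); rewrite ?rot_porbit.
by exists (level x.1); rewrite ?rot_porbit.
Qed.

Definition white_face_of (i : 'I_m) : {set bicolored_of} :=
  [set x : bicolored_of | x.2 && (strand x.1 \in first_cycle M i)].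

Definition gray_face_of (j : 'I_n) : {set bicolored_of} :=
  [set x : bicolored_of | ~~ x.2 && (gray_base x.1 \in last_cycle M j)].

Lemma first_cycles : is_labeling (porbits (sigma_nat M 0)) (first_cycle M).
Proof. by have := first_cycleP M; rewrite -(sigma_natE M ord0). Qed.

Lemma last_cycles : is_labeling (porbits (sigma_nat M r)) (last_cycle M).
Proof. by have := last_cycleP M; rewrite -(sigma_natE M ord_max). Qed.

Lemma white_face_ofE e i : strand e \in first_cycle M i ->
  white_face_of i = face_of ((e, true) : bicolored_of).
Proof.
move=> eE; apply/setP=> x; rewrite face_true inE.
by rewrite (labeling_porbit first_cycles eE).
Qed.

Lemma gray_face_ofE e j : gray_base e \in last_cycle M j ->
  gray_face_of j = face_of ((e, false) : bicolored_of).
Proof.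
move=> eE; apply/setP=> x; rewrite face_false inE.
by rewrite (labeling_porbit last_cycles eE).
Qed.

Lemma white_face_of_exists i : exists e, strand e \in first_cycle M i.
Proof.
have [y yi] := labeling_nonempty i first_cycles.
have [e] := exists_edge_orbit y (leq0n r); rewrite base0 => H.
exists e; rewrite (labeling_porbit first_cycles yi).
apply: porbit_mem_trans H _.
by have := porbit_next (sigma_nat M 0) ((sigma_nat M 0)^-1%g (val e).2); rewrite permKV.
Qed.

Lemma gray_face_of_exists j : exists e, gray_base e \in last_cycle M j.
Proof.
have [y yi] := labeling_nonempty j last_cycles.
have [e] := exists_edge_orbit y (leqnn r) => H.
by exists (swap e); rewrite (labeling_porbit last_cycles yi) /gray_base swapK.
Qed.

Lemma white_face_of_labeling : is_labeling (white bicolored_of) white_face_of.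
Proof.
split=> [i j E|].
  have [e eE] := white_face_of_exists i.
  have: ((e, true) : bicolored_of) \in white_face_of j by rewrite -E inE eE.
  rewrite inE /= => eE'; have [inj _] := first_cycles; apply: inj.
  by rewrite (labeling_porbit first_cycles eE) (labeling_porbit first_cycles eE').
apply/setP=> F; apply/imsetP/imsetP=> [[i _ ->]|[e _ ->]].
  by have [e eE] := white_face_of_exists i; exists e; rewrite ?(white_face_ofE eE).
have [i eE] := labeling_exists (strand e) first_cycles.
by exists i; rewrite ?(white_face_ofE eE).
Qed.

Lemma gray_face_of_labeling : is_labeling (gray bicolored_of) gray_face_of.
Proof.
split=> [i j E|].
  have [e eE] := gray_face_of_exists i.
  have: ((e, false) : bicolored_of) \in gray_face_of j by rewrite -E inE eE.
  rewrite inE /= => eE'; have [inj _] := last_cycles; apply: inj.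
  by rewrite (labeling_porbit last_cycles eE) (labeling_porbit last_cycles eE').
apply/setP=> F; apply/imsetP/idP=> [[i _ ->]|].
  have [e eE] := gray_face_of_exists i; rewrite (gray_face_ofE eE).
  by apply: face_of_gray; rewrite natural_of.
move=> gF; have fF : F \in faces bicolored_of by move: gF; rewrite inE => /andP[].
have /imsetP[x _ FE] := fF; have xF : x \in F by rewrite FE porbit_id.
have := natural_mem_gray gF xF; rewrite natural_of; case: x => e [] //= in FE xF * => _.
have [i eE] := labeling_exists (gray_base e) last_cycles.
by exists i; rewrite ?inE // (gray_face_ofE eE); apply: FE.
Qed.

Definition mnr_of : mnr_graph m n r :=
  MnrGraph vertices_of vertex_of_labeling white_face_of_labeling
    gray_face_of_labeling.

(** * Weights and tick marks of the reconstructed graph *)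

Definition weight_of (x : mnr_of) : nat :=
  helix_weight M (val (if x.2 then x.1 else left^-1%g x.1)).

Lemma weight_of_opp (x : mnr_of) : weight_of (opp mnr_of x) = weight_of x.
Proof.
rewrite /weight_of /= dart_oppE /opp_fun.
by case: x => e [] /=; rewrite ?permK.
Qed.

Lemma edge_weightE (e : edge) :
  level e + return_time M (val e) = helix_weight M (val e) * r + level (left e).
Proof. by rewrite /level val_left -helix_weightE. Qed.

(** The return time is at least 1, so an edge of weight 0 ends at a strictly higher level. *)
Lemma weight_of_positive (x : mnr_of) (i j : 'I_r) :
  natural x -> x \in vertex mnr_of i -> opp mnr_of x \in vertex mnr_of j ->
  j <= i -> 0 < weight_of x.
Proof.
case: x => e b; rewrite natural_of /= => -> /[!inE] /= /eqP <-.
rewrite dart_oppE /= => /eqP <- le; rewrite /weight_of /= lt0n.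
apply/eqP=> w0; have := edge_weightE e; rewrite w0 mul0n add0n => E.
by move: le; rewrite -E /return_time; lia.
Qed.

(** These are the times at which the flow from [e] visits the top level; the visit number [k],
    counted from 0, is the tick mark of rank [k] on [e]. *)
Lemma iter_edge (e : edge) k : k < helix_weight M (val e) ->
  k * r + (r.-1 - level e) < return_time M (val e) /\
  iter (k * r + (r.-1 - level e)) (helix M 0) (val e) =
    (top, iter k (sigma_nat M 0) (strand e)).
Proof.
move=> ltk; have E := edge_weightE e; have lte := ltn_ord (level e).
have ltj : k * r + (r.-1 - level e) < return_time M (val e).
  by have := leq_mul ltk (leqnn r); rewrite mulSn; lia.
split=> //; have [] := iter_helix0 r_gt0 M (k * r + (r.-1 - level e)) (val e).
have -> : (val e).1 + (k * r + (r.-1 - level e)) = k * r + r.-1.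
  by rewrite -/(level e); lia.
rewrite modnMDl divnMDl // modn_small ?divn_small ?prednK // addn0.
case: (iter _ _ _) => i y /= iE ->; congr (_, _); apply: val_inj.
by rewrite /= iE /= subn1.
Qed.

Definition tick_on (y : 'I_d) (t : edge * nat) : bool :=
  (t.2 < helix_weight M (val t.1)) && (iter t.2 (sigma_nat M 0) (strand t.1) == y).

(** The edge carrying [y] is the last moved point met up to [(top, y)], found as one that reaches it
    in the fewest steps. *)
Lemma tick_on_exists y : exists t, tick_on y t.
Proof.
have ex : exists j, [exists e : edge, iter j (helix M 0) (val e) == (top, y)].
  have [k mk] := meets_moved r_gt0 M (top, y) (leq0n r).
  have: (top, y) \in porbit (helix M 0) (iter k (helix M 0) (top, y)).
    by rewrite porbit_sym -permX mem_porbit.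
  case/porbitP=> j; rewrite permX => E; exists j; apply/existsP.
  by exists (exist (fun z => moved M z) _ mk); rewrite /= -E.
case: (ex_minnP ex) => j /existsP[e /eqP jE] minj.
(* Otherwise [left e] would reach the point sooner. *)
have ltj : j < return_time M (val e).
  rewrite ltnNge; apply/negP=> le.
  have := minj (j - return_time M (val e)).
  rewrite leqNgt ltn_subrL /= (leq_trans _ le) // => H; suff: false by [].
  apply: H; apply/existsP; exists (left e); rewrite val_left return_pointE -iterD subnK //.
  exact/eqP.
have [] := iter_helix0 r_gt0 M j (val e); rewrite jE /= => iE yE.
exists (e, (level e + j) %/ r); rewrite /tick_on /= yE eqxx andbT.
rewrite /helix_weight -/(level e).
have Ej : level e + j = (level e + j) %/ r * r + r.-1.
  by rewrite {1}(divn_eq (level e + j) r) -iE /= subn1.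
have: ((level e + j) %/ r).+1 * r <= level e + return_time M (val e).
  by rewrite mulSn; move: ltj Ej r_gt0; lia.
by move=> H; rewrite leq_divRL.
Qed.

(** If the travel times to [(top, y)] differed, the nearer edge would be a moved point on the path
    of the farther one before its return. *)
Lemma tick_on_unique y t t' : tick_on y t -> tick_on y t' -> t = t'.
Proof.
wlog le : t t' / t.2 * r + (r.-1 - level t.1) <= t'.2 * r + (r.-1 - level t'.1).
  move=> H; case: (leqP (t.2 * r + (r.-1 - level t.1))
                        (t'.2 * r + (r.-1 - level t'.1))) => [le|/ltnW le].
    exact: H.
  by move=> H1 H2; apply/esym/H.
case: t t' le => e k [e' k'] /= le /andP[/= /iter_edge[_ E] /eqP yE].
case/andP=> /= /iter_edge[lt' E'] /eqP yE'.
set j := k * r + _ in le E; set j' := k' * r + _ in le E' lt'.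
have inj i : injective (iter i (helix M 0)).
  by elim: i => [//|i IH] u v /= /perm_inj /IH.
have eE : val e = iter (j' - j) (helix M 0) (val e').
  by apply: (inj j); rewrite -iterD subnKC // E' E yE yE'.
case: (posnP (j' - j)) => [jj|jj]; last first.
  have := return_time_min r_gt0 (M := M) (z := val e') (j := j' - j).
  rewrite jj (leq_ltn_trans (leq_subr _ _) lt') -eE => /(_ isT).
  by rewrite (valP e).
have ee : e = e' by apply: val_inj; rewrite /= eE jj.
have jE : j = j' by apply/eqP; rewrite eqn_leq le -subn_eq0 jj.
move: jE; rewrite /j /j' ee => /eqP; rewrite eqn_add2r eqn_pmul2r //.
by move/eqP=> ->.
Qed.

Definition tick_edge (y : 'I_d) : edge := (xchoose (tick_on_exists y)).1.
Definition tick_rank (y : 'I_d) : nat := (xchoose (tick_on_exists y)).2.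

Lemma tick_onP y : tick_on y (tick_edge y, tick_rank y).
Proof. by rewrite -surjective_pairing; apply: xchooseP. Qed.

Lemma tick_rank_lt y : tick_rank y < helix_weight M (val (tick_edge y)).
Proof. by have /andP[] := tick_onP y. Qed.

Lemma tick_strand y : iter (tick_rank y) (sigma_nat M 0) (strand (tick_edge y)) = y.
Proof. by have /andP[_ /eqP] := tick_onP y. Qed.

Lemma tick_on_eq y e k : tick_on y (e, k) -> tick_edge y = e /\ tick_rank y = k.
Proof. by move=> H; have [-> ->] := tick_on_unique (tick_onP y) H. Qed.

Lemma tick_iter e k : k < helix_weight M (val e) ->
  tick_edge (iter k (sigma_nat M 0) (strand e)) = e /\
  tick_rank (iter k (sigma_nat M 0) (strand e)) = k.
Proof. by move=> lt; apply: tick_on_eq; rewrite /tick_on /= lt eqxx. Qed.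

Lemma tick_strand_porbit y : y \in porbit (sigma_nat M 0) (strand (tick_edge y)).
Proof. by rewrite -{1}(tick_strand y) -permX mem_porbit. Qed.

(** [(left e, false)] reverses the edge [e] of [y]. Until the return, [helix r] follows [helix 0],
    so [(top, y)] also lies on the orbit of [e] under [helix r]. *)
Lemma tick_gray_porbit y :
  y \in porbit (sigma_nat M r) (gray_base (left (tick_edge y))).
Proof.
set e := tick_edge y.
have E : gray_base (left e) = base M r (return_point M r (val e)).
  by rewrite /gray_base -val_right permM.
have H1 := return_base_porbit r_gt0 M (val e) (leqnn r).
have [ltj jE] := iter_edge (tick_rank_lt y); rewrite tick_strand -/e in ltj jE.
have H2 : (top, y) \in porbit (helix M r) (val e).
  by rewrite -jE -(iter_helix_return r_gt0 r ltj) -permX mem_porbit.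
rewrite (helix_porbit r_gt0) // in H2.
have H3 : y \in porbit (sigma_nat M r) (base M r (top, y)).
  have -> : base M r (top, y) = (sigma_nat M r)^-1%g y.
    by rewrite /base (topE r_gt0) minnn.
  by have := porbit_next (sigma_nat M r) ((sigma_nat M r)^-1%g y); rewrite permKV.
rewrite porbit_sym in H1; rewrite E.
exact: porbit_mem_trans H1 (porbit_mem_trans H2 H3).
Qed.

Lemma sum_weight_of (P : pred mnr_of) :
  \sum_(x : mnr_of | x.2 && P x) weight_of x = #|[set y | P (tick_edge y, true)]|.
Proof.
apply: (@sum_ticks _ _ _ _ _ (fun y => (tick_edge y, true) : mnr_of) tick_rank) => //.
- exact: tick_rank_lt.
- by move=> y y' [E] E'; rewrite -(tick_strand y) -(tick_strand y') E E'.
case=> e [] // k _ lt; have [E1 E2] := @tick_iter e k lt.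
by exists (iter k (sigma_nat M 0) (strand e)); rewrite ?E1 ?E2.
Qed.

Lemma white_balanced_of i :
  \sum_(x in white_face mnr_of i) weight_of x = tnth mu i.
Proof.
rewrite -(card_first_cycle M) (eq_bigl
  (fun x : mnr_of => x.2 && (strand x.1 \in first_cycle M i))) => [|x]; last first.
  by rewrite inE.
rewrite sum_weight_of; apply: eq_card => y; rewrite inE /=.
by rewrite (labeling_closed i first_cycles (tick_strand_porbit y)).
Qed.

Lemma gray_balanced_of j :
  \sum_(x in gray_face mnr_of j) weight_of x = tnth nu j.
Proof.
rewrite -(card_last_cycle M) (reindex_inj (@perm_inj _ (opp mnr_of))) /=.
rewrite (eq_bigr _ (fun x _ => weight_of_opp x)).
rewrite (eq_bigl
  (fun x : mnr_of => x.2 && (gray_base (left x.1) \in last_cycle M j))).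
  rewrite sum_weight_of; apply: eq_card => y; rewrite inE /=.
  by rewrite (labeling_closed j last_cycles (tick_gray_porbit y)).
by move=> x; rewrite inE dart_oppE /opp_fun; case: x => e [].
Qed.

Definition graph_of : hurwitz_graph g mu nu :=
  HurwitzGraph weight_of_opp weight_of_positive white_balanced_of
    gray_balanced_of.

Lemma natural_true e : natural ((e, true) : graph_of).
Proof. by rewrite natural_of. Qed.

Definition label (y : 'I_d) : tick graph_of :=
  exist (fun t : {x : graph_of & 'I_(weight x)} => natural (tag t))
    (Tagged (fun x : graph_of => 'I_(weight x))
       (Ordinal (tick_rank_lt y : tick_rank y < weight ((tick_edge y, true) : graph_of))))
    (natural_true (tick_edge y)).

Lemma label_bij : bijective label.
Proof.
exists (fun t : tick graph_of =>
          iter (tick_pos t) (sigma_nat M 0) (strand (tick_dart t).1)).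
  by move=> y; apply: tick_strand.
move=> t; have := tick_natural t; have := tick_pos_lt t; rewrite natural_of.
case tE: (tick_dart t) => [e []] // lt _.
have [E E'] := @tick_iter e _ lt.
apply: tick_eq; rewrite /tick_dart /tick_pos /=; first by rewrite E -tE.
exact: E'.
Qed.

Lemma turn_of s e : turn s ((e, true) : graph_of) =
  ((if s <= level (left e) then left e else right e), true) :> graph_of.
Proof.
have vE : vtx (opp graph_of ((e, true) : graph_of)) = level (left e).
  by apply/eqP; rewrite -mem_vertex inE /= dart_oppE eqxx.
rewrite turnE vE; case: ifP => _; first exact: left_true.
by rewrite turn_rightE /= dart_oppE dart_rotE /rot_fun /= permM.
Qed.

(** Both the rule of [sigma_s] and the flow [helix s] cross exactly at the levels below [s], so a
    turn is the flow during one return time. *)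
Lemma val_turn s e : val (if s <= level (left e) then left e else right e) =
  iter (return_time M (val e)) (helix M s) (val e).
Proof.
rewrite iter_helix_returnE // /flip -val_left -/(level _) ltnNge.
case: ifP => _ /=; first by rewrite -surjective_pairing.
by rewrite permM swapE.
Qed.

(** [r.-1 - level e] is the time until the top level is next visited; the induction is on this
    distance, as edges of weight 0 go up. *)
Lemma first_tick_of s e y :
  iter (r.-1 - level e) (helix M s) (val e) = (top, y) ->
  first_tick s ((e, true) : graph_of) (label y).
Proof.
have [k] := ubnP (r - level e); elim: k e => // k IHk e ltk E.
have ltr := ltn_ord (level e); have wE := edge_weightE e.
case w: (helix_weight M (val e)) => [|w'].
  move: wE; rewrite w mul0n add0n => lE.
  right; first by [].
  rewrite turn_of; set f := if _ then _ else _.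
  have fE : level f = level (left e).
    by rewrite /f; case: ifP => // _; rewrite permM level_swap.
  have ltf := ltn_ord (level f).
  apply: IHk; first by move: ltk; rewrite fE -lE /return_time; lia.
  rewrite val_turn -iterD -E; congr (iter _ _ _).
  by move: ltf; rewrite fE; move: lE; lia.
have lt0 : 0 < helix_weight M (val e) by rewrite w.
have [] := iter_edge lt0; rewrite mul0n add0n /= => ltN E0.
have yE : y = strand e by move: E; rewrite (iter_helix_return r_gt0 s ltN) E0 => -[].
have [te tr] := tick_iter lt0; rewrite /= -yE in te tr.
have H : tick_pos (label y) = 0 by exact: tr.
by have := @FirstTickHere _ _ _ _ _ graph_of s (label y) H; rewrite /tick_dart /= te.
Qed.

(** One lap of [helix s] is [sigma_s]. From a tick mark it either stays on the edge up to the next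
    mark, or passes its end and finishes as in [first_tick_of]. *)
Lemma next_tick_of s y : s <= r -> next_tick s (label y) (label (sigma_nat M s y)).
Proof.
move=> les; set e := tick_edge y; set k := tick_rank y.
have ltk : k < helix_weight M (val e) := tick_rank_lt y.
have [ltj jE] := iter_edge ltk; rewrite /k tick_strand -/k in jE.
have wE := edge_weightE e.
set j := k * r + _ in ltj jE.
have jsE i : iter (i + j) (helix M s) (val e) = iter i (helix M s) (top, y).
  by rewrite iterD (iter_helix_return r_gt0 s ltj) jE.
have lapE := jsE r; rewrite helix_lap // in lapE.
move: (ltk); rewrite leq_eqVlt => /orP[/eqP kw|lt].
  right; split; first exact: kw.
  rewrite [tick_dart _]/=  turn_of; set f := if _ then _ else _.
  have fE : level f = level (left e).
    by rewrite /f; case: ifP => // _; rewrite permM level_swap.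
  apply: first_tick_of; rewrite val_turn -iterD -lapE; congr (iter _ _ _).
  have := ltn_ord (level f); have := ltn_ord (level e).
  by rewrite fE /j -/e; move: wE; rewrite -kw mulSn; lia.
left; have [lt' jE'] := iter_edge lt.
have jj : r + j = k.+1 * r + (r.-1 - level e) by rewrite /j mulSn addnA.
have sE : iter k.+1 (sigma_nat M 0) (strand e) = sigma_nat M s y.
  move: lapE; rewrite jj (iter_helix_return r_gt0 s lt') jE'.
  by case.
have [te tr] := tick_iter lt; rewrite sE in te tr.
rewrite /tick_dart /tick_pos /=; split; last exact: tr.
by rewrite te.
Qed.

Lemma traces_graph_of : traces label M.
Proof.
have wF i : white_face graph_of i \in white graph_of.
  by have [_ <-] := white_faceP graph_of; apply: imset_f.
have gF j : gray_face graph_of j \in gray graph_of.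
  by have [_ <-] := gray_faceP graph_of; apply: imset_f.
split=> [i k|i|j].
- by rewrite -sigma_natE; apply: next_tick_of; rewrite -ltnS.
- apply/setP=> y; rewrite mem_ticks_white // /edge_of /tick_dart inE /=.
  exact: (labeling_closed i first_cycles (tick_strand_porbit y)).
- apply/setP=> y; rewrite mem_ticks_gray // /edge_of /tick_dart inE /= dart_oppE /=.
  exact: (labeling_closed j last_cycles (tick_gray_porbit y)).
Qed.

End Reconstruction.

(** * Isomorphism classes *)

Lemma iso_class_eq (T : Type) (R : T -> T -> Prop) (C D : iso_class R) :
  (forall x, sval C x <-> sval D x) -> C = D.
Proof.
case: C D => [P eP] [Q eQ] /= PQ.
have E : P = Q by apply/funext=> x; apply/propext.
by case: Q / E eQ PQ => eQ _; congr exist; apply: Prop_irrelevance.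
Qed.

Section ClassBijection.

Variables (A B : Type) (RA : A -> A -> Prop) (RB : B -> B -> Prop).
Variable T : A -> B -> Prop.

Hypothesis T_left : forall a, exists b, T a b.
Hypothesis T_right : forall b, exists a, T a b.
Hypothesis T_inj : forall a a' b, T a b -> T a' b -> RA a a'.
Hypothesis T_fun : forall a b b', T a b -> T a b' -> RB b b'.
Hypothesis T_RA : forall a a' b, RA a a' -> T a b -> T a' b.
Hypothesis T_RB : forall a b b', RB b b' -> T a b -> T a b'.

(** A class is sent to all objects related to its members, so the map involves no choice of
    representatives. *)
Lemma image_class (C : iso_class RA) :
  exists b, (fun b => exists2 a, sval C a & T a b) = RB b.
Proof.
case: C => P [a PE] /=; have [b Tab] := T_left a; exists b.
apply/funext=> b'; apply/propext; rewrite PE; split=> [[a' Raa' Tab']|Rbb'].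
  exact: T_fun (T_RA Raa' Tab) Tab'.
(* [T_inj] applied twice to the same pair is reflexivity of [RA]. *)
by exists a; [exact: (T_inj Tab Tab) | exact: T_RB Rbb' Tab].
Qed.

Lemma preimage_class (D : iso_class RB) :
  exists a, (fun a => exists2 b, sval D b & T a b) = RA a.
Proof.
case: D => P [b PE] /=; have [a Tab] := T_right b; exists a.
apply/funext=> a'; apply/propext; rewrite PE; split=> [[b' Rbb' Tab']|Raa'].
  exact: T_inj (T_RB Rbb' Tab) Tab'.
by exists b; [exact: (T_fun Tab Tab) | exact: T_RA Raa' Tab].
Qed.

Lemma class_bijection : exists Phi : iso_class RA -> iso_class RB,
  (forall a b, T a b -> Phi (class_of RA a) = class_of RB b) /\ bijective Phi.
Proof.
pose Phi C : iso_class RB := exist _ _ (image_class C).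
pose Psi D : iso_class RA := exist _ _ (preimage_class D).
have PhiE a b : T a b -> Phi (class_of RA a) = class_of RB b.
  move=> Tab; apply: iso_class_eq => b' /=; split=> [[a' Raa' Tab']|Rbb'].
    exact: T_fun (T_RA Raa' Tab) Tab'.
  by exists a; [exact: (T_inj Tab Tab) | exact: T_RB Rbb' Tab].
have PsiE a b : T a b -> Psi (class_of RB b) = class_of RA a.
  move=> Tab; apply: iso_class_eq => a' /=; split=> [[b' Rbb' Tab']|Raa'].
    exact: T_inj (T_RB Rbb' Tab) Tab'.
  by exists b; [exact: (T_fun Tab Tab) | exact: T_RA Raa' Tab].
have classE U (R : U -> U -> Prop) (C : iso_class R) :
    exists x, C = class_of R x.
  by case: C => P [x PE]; exists x; apply: iso_class_eq; rewrite /= PE.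
exists Phi; split=> //; exists Psi => [C|D].
  have [a ->] := classE _ _ C; have [b Tab] := T_left a.
  by rewrite (PhiE _ _ Tab) (PsiE _ _ Tab).
have [b ->] := classE _ _ D; have [a Tab] := T_right b.
by rewrite (PsiE _ _ Tab) (PhiE _ _ Tab).
Qed.

End ClassBijection.

(** * Transport along isomorphisms *)

Section Transport.

Variables (g d m n : nat) (mu : m.-tuple nat) (nu : n.-tuple nat).

Definition realizes (G : hurwitz_graph g mu nu)
    (M : monodromy_sequence g d mu nu) : Prop :=
  exists2 lab : 'I_d -> tick G, bijective lab & traces lab M.

(** Conjugation by [h] is absorbed by relabeling the tick marks with [lab \o h]. *)
Lemma realizes_monodromy_iso (G : hurwitz_graph g mu nu)
    (M N : monodromy_sequence g d mu nu) :
  monodromy_iso M N -> realizes G M -> realizes G N.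
Proof.
case=> h [sE fE lE] [lab lab_bij [H Hf Hl]].
have preim (C : {set 'I_d}) F : C = ticks_on lab F ->
    h^-1%g @: C = ticks_on (lab \o h) F.
  move=> ->; apply/setP=> k; apply/imsetP/idP=> [[l lF ->]|kF].
    by move: lF; rewrite !inE /= permKV.
  by exists (h k); rewrite ?permK //; move: kF; rewrite !inE.
exists (lab \o h); first by apply: bij_comp lab_bij (injF_bij (@perm_inj _ h)).
split=> [i k|i|j].
- by have := H i (h k); rewrite -(sE i) !comp_permE /= permKV.
- by rewrite -fE; apply: preim.
- by rewrite -lE; apply: preim.
Qed.

Hypothesis d_gt0 : 0 < d.

Lemma traces_monodromy_iso (G : hurwitz_graph g mu nu) (lab lab' : 'I_d -> tick G)
    (M N : monodromy_sequence g d mu nu) :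
  bijective lab -> bijective lab' -> traces lab M -> traces lab' N ->
  monodromy_iso M N.
Proof.
move=> lab_bij lab'_bij labM labN.
have [H Hf Hl] := labM; have [H' Hf' Hl'] := labN.
have [inv labK invK] := lab_bij.
have h_inj : injective (inv \o lab').
  exact: inj_comp (can_inj invK) (bij_inj lab'_bij).
pose h := perm h_inj.
have labE k : lab (h k) = lab' k by rewrite permE /= invK.
have preim F : h^-1%g @: ticks_on lab F = ticks_on lab' F.
  apply/setP=> k; apply/imsetP/idP=> [[l lF ->]|kF].
    by move: lF; rewrite !inE -!labE permKV.
  by exists (h k); rewrite ?permK //; move: kF; rewrite !inE labE.
exists h; split=> [i|i|j]; last 2 first.
- by rewrite Hf Hf' preim.
- by rewrite Hl Hl' preim.
apply/permP=> k; rewrite !comp_permE; apply: (@perm_inj _ h); rewrite permKV.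
rewrite (traces_sigma d_gt0 lab_bij labM); apply/esym.
apply: (next_travel_unique d_gt0 lab_bij); rewrite !labE.
exact: H'.
Qed.

Section GraphIso.

Variables (G H : hurwitz_graph g mu nu) (f : G -> H).
Hypothesis f_bij : bijective f.
Hypothesis f_opp : forall x, f (opp G x) = opp H (f x).
Hypothesis f_rot : forall x, f (rot G x) = rot H (f x).
Hypothesis f_white : forall F, F \in faces G -> (f @: F \in white H) = (F \in white G).
Hypothesis f_vertex : forall i, f @: vertex G i = vertex H i.
Hypothesis f_weight : forall x, weight (f x) = weight x.

Lemma iso_left x : f (turn_left G x) = turn_left H (f x).
Proof.
apply: (@perm_inj _ (rot H)); rewrite -f_rot !permM !permKV.
exact: f_opp.
Qed.

Lemma iso_natural x : natural (f x) = natural x.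
Proof.
suff E : face_of (f x) = f @: face_of x by rewrite /natural E f_white ?imset_f.
apply/setP=> y; have [inv _ invK] := f_bij.
rewrite -(invK y) mem_imset; last exact: (bij_inj f_bij).
by apply: mem_porbit_morph; [exact: (bij_inj f_bij) | exact: iso_left].
Qed.

Lemma iso_vtx x : vtx (f x) = vtx x.
Proof.
apply/eqP; rewrite -mem_vertex -f_vertex mem_imset; last exact: (bij_inj f_bij).
by rewrite mem_vertex.
Qed.

Lemma iso_turn s x : f (turn s x) = turn s (f x).
Proof.
rewrite !turnE -f_opp iso_vtx; case: ifP => _; first exact: iso_left.
by rewrite !permM f_rot f_opp.
Qed.

Lemma iso_tick_exists (t : tick G) : exists u : tick H,
  (tick_dart u == f (tick_dart t)) && (tick_pos u == tick_pos t).
Proof.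
have nf : natural (f (tick_dart t)) by rewrite iso_natural tick_natural.
have lt : tick_pos t < weight (f (tick_dart t)) by rewrite f_weight tick_pos_lt.
by have [u D P] := tick_exists nf lt; exists u; rewrite D P !eqxx.
Qed.

Definition iso_tick (t : tick G) : tick H := xchoose (iso_tick_exists t).

Lemma iso_tickP t : tick_dart (iso_tick t) = f (tick_dart t) /\
  tick_pos (iso_tick t) = tick_pos t.
Proof. by have /andP[/eqP D /eqP P] := xchooseP (iso_tick_exists t). Qed.

Lemma iso_tick_inj : injective iso_tick.
Proof.
move=> t u E; have [D1 P1] := iso_tickP t; have [D2 P2] := iso_tickP u.
by apply: tick_eq; [apply: (bij_inj f_bij); rewrite -D1 E | rewrite -P1 E].
Qed.

Lemma iso_first_tick s x t : first_tick s x t -> first_tick s (f x) (iso_tick t).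
Proof.
elim=> {x t} [t t0|x t wx _ IH].
  have [D P] := iso_tickP t; rewrite -D.
  by left; rewrite P.
by right; rewrite ?f_weight // -iso_turn.
Qed.

Lemma iso_next_tick s t u : next_tick s t u -> next_tick s (iso_tick t) (iso_tick u).
Proof.
have [D1 P1] := iso_tickP t; have [D2 P2] := iso_tickP u.
rewrite /next_tick D1 D2 P1 P2 f_weight -iso_turn.
by case=> [[-> ->]|[? ?]]; [left|right; split=> //; apply: iso_first_tick].
Qed.

Lemma iso_ticks_on (lab : 'I_d -> tick G) (F : {set G}) :
  ticks_on (iso_tick \o lab) (f @: F) = ticks_on lab F.
Proof.
apply/setP=> k; rewrite !inE /=; have [-> _] := iso_tickP (lab k).
by rewrite -f_opp !mem_imset //; apply: (bij_inj f_bij).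
Qed.

End GraphIso.

Hypothesis mu_sum : sumn mu = d.

Lemma realizes_hurwitz_iso (G H : hurwitz_graph g mu nu)
    (M : monodromy_sequence g d mu nu) :
  hurwitz_iso G H -> realizes G M -> realizes H M.
Proof.
case=> f [f_bij [f_opp f_rot] f_white [f_vtx f_wf f_gf] f_wt] [lab lab_bij [Hn Hf Hl]].
pose phi := iso_tick f_bij f_opp f_rot f_white f_wt.
exists (phi \o lab).
  (* Injectivity suffices, since [H] also has [d] tick marks. *)
  apply: inj_card_bij; last by rewrite card_ord (card_tick _ mu_sum).
  by apply: inj_comp (bij_inj lab_bij); apply: iso_tick_inj.
split=> [i k|i|j].
- exact: iso_next_tick.
- by rewrite Hf -f_wf iso_ticks_on.
- by rewrite Hl -f_gf iso_ticks_on.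
Qed.

Lemma exists_labeling (G : hurwitz_graph g mu nu) :
  exists lab : 'I_d -> tick G, bijective lab.
Proof.
have E : d = #|{: tick G}| by rewrite (card_tick _ mu_sum).
exists (fun k => enum_val (cast_ord E k)).
by apply: bij_comp (enum_val_bij _) (Bijective (cast_ordK E) (cast_ordKV E)).
Qed.

End Transport.

Unset Implicit Arguments.
Theorem mainTheorem1 (g d m n : nat) (mu : m.-tuple nat) (nu : n.-tuple nat)
    (hd : 0 < d) (hmu : is_partition d mu) (hnu : is_partition d nu)
    (hr : 0 < num_branch g m n) :
  [/\ forall G : hurwitz_graph g mu nu,
        #|{: tick G}| = d /\
        forall lab : 'I_d -> tick G, bijective lab ->
          (forall (i : 'I_(num_branch g m n).+1) (k : 'I_d),
             exists! l : 'I_d, next_tick i (lab k) (lab l)) /\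
          exists M : monodromy_sequence g d mu nu,
            [/\ traces lab M,
                {in white G &, injective (ticks_on lab)}
                  /\ ticks_on lab @: white G = porbits (sigma M ord0)
              & {in gray G &, injective (ticks_on lab)}
                  /\ ticks_on lab @: gray G = porbits (sigma M ord_max)],
      forall (G : hurwitz_graph g mu nu) (lab lab' : 'I_d -> tick G)
             (M M' : monodromy_sequence g d mu nu),
        bijective lab -> bijective lab' ->
        traces lab M -> traces lab' M' -> monodromy_iso M M'
    & exists Phi : iso_class (@hurwitz_iso g m n mu nu) ->
                   iso_class (@monodromy_iso g d m n mu nu),
        (forall (G : hurwitz_graph g mu nu) (lab : 'I_d -> tick G)
                (M : monodromy_sequence g d mu nu),
           bijective lab -> traces lab M ->
           Phi (class_of (@hurwitz_iso g m n mu nu) G) =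
           class_of (@monodromy_iso g d m n mu nu) M)
        /\ bijective Phi].
Proof.
have mu_sum : sumn mu = d by case/and3P: hmu => _ _ /eqP.
split.
- move=> G; split; first exact: card_tick.
  move=> lab lab_bij; split=> [i k|].
    exists (travel hd lab_bij i k); split; first exact: next_travel.
    by move=> l /(next_travel_unique hd lab_bij).
  exists (monodromy_of hd lab_bij); split; first exact: traces_monodromy_of.
    exact: (ticks_white_labeling hd lab_bij).
  exact: (ticks_gray_labeling hd lab_bij).
- by move=> G lab lab' M M'; apply: traces_monodromy_iso.
have [||||||Phi [PhiE Phi_bij]] := @class_bijection (hurwitz_graph g mu nu)
  (monodromy_sequence g d mu nu) (@hurwitz_iso g m n mu nu)
  (@monodromy_iso g d m n mu nu) (@realizes g d m n mu nu).
- move=> G; have [lab lab_bij] := exists_labeling mu_sum G.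
  exists (monodromy_of hd lab_bij), lab => //; exact: traces_monodromy_of.
- move=> M; exists (graph_of hr M), (label hr M); first exact: label_bij.
  exact: traces_graph_of.
- move=> G G' M [lab lab_bij labM] [lab' lab'_bij labM'].
  exact: traces_iso labM labM'.
- move=> G M M' [lab lab_bij labM] [lab' lab'_bij labM'].
  exact: traces_monodromy_iso labM labM'.
- by move=> G G' M; apply: realizes_hurwitz_iso.
- by move=> G M M'; apply: realizes_monodromy_iso.
exists Phi; split=> // G lab M lab_bij labM.
by apply: PhiE; exists lab.
Qed.
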